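(* There exists an absolute constant $c>0$ such that the following holds. Let $n$ be a non-negative integer and let $X$ be a random variable taking values in $\{0,\ldots,n\}$ with $\mathbb{P}(X=0)\,\mathbb{P}(X=n)>0$ and probability generating function $f_X$. Let $\delta>0$ and $R\geq 1$. If all zeros $\zeta\in\mathbb{C}$ of $f_X$ satisfy $|\arg(\zeta)|\geq\delta$ and $R^{-1}\leq|\zeta|\leq R$, then $$\mathrm{Var}(X)\geq c\,R^{-2\pi/\delta}\,n .$$
   Context: For a random variable $X$ with values in $\{0,\ldots,n\}$, its probability generating function is the polynomial $f_X(z)=\sum_{k=0}^n\mathbb{P}(X=k)z^k$, $z\in\mathbb{C}$. For $z\in\mathbb{C}\setminus\{0\}$ write $z=re^{i\theta}$ with $r>0$ and $\theta\in[-\pi,\pi]$; then $\arg(z)=\theta$ (so $|\arg(z)|\in[0,\pi]$ is well defined). *)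

(* Defs.v *)
From mathcomp Require Export all_boot all_order all_algebra.
From mathcomp Require Export complex.
From mathcomp Require Export all_classical all_reals all_analysis.

Set Implicit Arguments.
Unset Strict Implicit.
Unset Printing Implicit Defensive.

Export Order.TTheory GRing.Theory Num.Theory.
Export numFieldNormedType.Exports.

Local Open Scope classical_set_scope.
Local Open Scope ring_scope.
Local Open Scope complex_scope.

(* [is_arg z t] : t is an argument of z in the closed interval [-pi, pi],
   i.e. z = r e^{it} for some r > 0.  Negative reals have the two arguments
   pi and -pi, and 0 has none. *)
Definition is_arg (R : realType) (z : R[i]) (t : R) : Prop :=
  - pi <= t <= pi /\
  exists2 r : R, 0 < r & z = r%:C * (cos t +i* sin t).

(* An unspecified choice among the arguments of z (0 if z = 0); only its
   absolute value is canonical, see [carg_spec] and [is_arg_norm]. *)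
Definition carg (R : realType) (z : R[i]) : R := xget 0 [set t | is_arg z t].

(* Probability generating function of a random variable with values in
   {0, ..., n}. *)
Definition pgf d (T : measurableType d) (R : realType) (P : probability T R)
    (X : {RV P >-> R}) (n : nat) : {poly R[i]} :=
  \poly_(k < n.+1) (pmf X k%:R)%:C.

Lemma is_arg_cos (R : realType) (z : R[i]) (t : R) :
  is_arg z t ->
  `|t| = acos (complex.Re z /
    Num.sqrt (complex.Re z ^+ 2 + complex.Im z ^+ 2)).
Proof.
move=> [/andP[t1 t2] [r r0 ->]] /=.
rewrite !mul0r subr0 addr0 !exprMn -mulrDr cos2Dsin2 mulr1.
rewrite sqrtr_sqr (gtr0_norm r0) (mulrC r) mulfK ?gt_eqF //.
have [t0|t0] := leP 0 t.
  by rewrite cosK ?ger0_norm ?in_itv /= ?t0.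
by rewrite -cosN cosK ?ltr0_norm // in_itv /= oppr_ge0 (ltW t0) lerNl t1.
Qed.

Lemma carg_spec (R : realType) (z : R[i]) : z != 0 -> is_arg z (carg z).
Proof.
move=> z0; rewrite /carg; case: xgetP => [t -> //|none]; exfalso.
case: z z0 none => a b z0 none.
set r := Num.sqrt (a ^+ 2 + b ^+ 2).
have ab0 : 0 < a ^+ 2 + b ^+ 2.
  rewrite lt_neqAle addr_ge0 ?sqr_ge0 // andbT eq_sym.
  rewrite paddr_eq0 ?sqr_ge0 // !sqrf_eq0.
  by apply: contra z0 => /andP[/eqP -> /eqP ->].
have r0 : 0 < r by rewrite sqrtr_gt0.
have rE : r ^+ 2 = a ^+ 2 + b ^+ 2 by rewrite sqr_sqrtr // ltW.
have ar : `|a / r| <= 1.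
  rewrite normrM normfV (gtr0_norm r0) ler_pdivrMr // mul1r.
  by rewrite -sqrtr_sqr ler_wsqrtr // lerDl sqr_ge0.
have arI : -1 <= a / r <= 1 by rewrite -ler_norml.
pose u := acos (a / r).
have cu : cos u = a / r by rewrite acosK // in_itv.
have su : sin u = `|b| / r.
  rewrite sin_acos //.
  have -> : 1 - (a / r) ^+ 2 = (b / r) ^+ 2.
    apply: (mulIf (x := r ^+ 2)); first by rewrite sqrf_eq0 gt_eqF.
    rewrite mulrBl mul1r !exprMn !exprVn !mulfVK ?sqrf_eq0 ?gt_eqF //.
    by rewrite rE addrAC subrr add0r.
  by rewrite sqrtr_sqr normrM normfV (gtr0_norm r0).
have u0 : 0 <= u by rewrite acos_ge0.
have up : u <= pi by rewrite acos_lepi.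
have rK x : r * (x / r) = x by rewrite mulrCA divff ?mulr1 // gt_eqF.
have [b0|b0] := leP 0 b.
  apply: (none u); split.
    by rewrite up andbT (le_trans _ u0) // oppr_le0 pi_ge0.
  exists r => //.
  by rewrite cu su (ger0_norm b0);
  apply/eqP; rewrite eq_complex /= !mul0r subr0 addr0 !rK !eqxx.
apply: (none (- u)); split.
  by rewrite lerN2 up /= (le_trans _ (pi_ge0 R)) // oppr_le0.
exists r => //.
by rewrite cosN sinN cu su (ltr0_norm b0) mulNr opprK;
  apply/eqP; rewrite eq_complex /= !mul0r subr0 addr0 !rK !eqxx.
Qed.

Lemma is_arg_norm (R : realType) (z : R[i]) (t : R) :
  is_arg z t -> `|t| = `|carg z|.
Proof.
move=> zt; have czt : is_arg z (carg z).
  by rewrite /carg; case: xgetP => [s -> //|/(_ t)]; case.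
by rewrite (is_arg_cos zt) (is_arg_cos czt).
Qed.

(* Main.v *)
Require Import Defs.
From mathcomp Require Import measurable_realfun ring lra.

(** Let [f] be the generating function and [logder f w = z f'(z) / f(z)], where
    [z = e^w]: the derivative of [log f(e^w)].  At a real [w] this is the mean of
    the law of [X] tilted by [e^w], and its slope at [w = 0] is the variance of
    [X].  Each root [t] contributes [z / (z - t)], whose real part is below 1/2
    when [|z| < |t|] and above when [|z| > |t|].  As all the moduli of the roots
    lie between [1/rho] and [rho], [logder f] increases by order [n * u] over the
    interval [-X, X], where [X = ln rho + u] with [u] at most 1 ([logder_gap]).
    It remains to see that this increase cannot take place far from 0 only.

    The first ingredient is a sign: [Im (logder f w) >= 0] on the line
    [Im w = delta / 2] ([Im_logder_ge0]).  Since [f] has nonnegative coefficients,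
    [|f(z)| <= f(|z|)].  Compare [|f(e^w)|] with its value at the point reflected
    across that line: the former is the larger on the real axis, the two agree on
    the line, and the maximum principle extends the inequality to the strip in
    between.  The modulus of [f] thus decreases as the argument grows across the
    line, which is the claimed sign.

    The second ingredient is a distortion bound ([logder_growth]).  Let
    [s = 2 pi / delta] or its opposite, so that [e^(s w)] opens the strip
    [0 <= Im w <= delta / 2] into a half-plane, the upper side being sent to the
    negative axis.  The divided difference
    [(logder f w - logder f 0) / (e^(s w) - 1)] is real on the real axis, and its
    imaginary part is nonpositive on the upper side by the first ingredient,
    hence everywhere ([Im_dquot_le0]).  So it decreases along the reals, and
    comparison with its limit at 0 gives
    [|logder f x - logder f 0| <= V (e^|s x| - 1) / |s|], where [V] is the slope
    at 0.  With [x = X, -X] and [u = 1 / |s|] this yields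
    [V >= n rho^(- 2 pi / delta) / 24] ([logder_slope_lower]).

    Holomorphy enters only through second-order expansions with a cubic error
    ([jet]), which suffice for a maximum principle on strips
    ([strip_maximum_principle]). *)

Set Implicit Arguments.
Unset Strict Implicit.
Unset Printing Implicit Defensive.

Import Normc.

Local Open Scope ring_scope.
Local Open Scope complex_scope.

(** * Modulus and real part of complex numbers *)

Section ComplexModulus.
Variable R : realType.
Local Notation C := R[i].
Implicit Types (z w : C).

Lemma normc_ge0 z : 0 <= normc z.
Proof. by case: z => a b; rewrite sqrtr_ge0. Qed.

Lemma normc_gt0 z : z != 0 -> 0 < normc z.
Proof.
move=> z0; rewrite lt_neqAle normc_ge0 andbT eq_sym.
by apply: contra z0 => /eqP/eq0_normc ->.
Qed.

Lemma normcX z n : normc (z ^+ n) = normc z ^+ n.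
Proof. by elim: n => [|n IH]; rewrite ?expr0 ?normc1 // !exprS normcM IH. Qed.

Lemma normc_real (x : R) : normc x%:C = `|x|.
Proof. by rewrite /= expr0n /= addr0 sqrtr_sqr. Qed.

Lemma normc_Re_le z : `|complex.Re z| <= normc z.
Proof. by case: z => a b /=; rewrite -sqrtr_sqr ler_wsqrtr// lerDl sqr_ge0. Qed.

Lemma normc_Im_le z : `|complex.Im z| <= normc z.
Proof. by case: z => a b /=; rewrite -sqrtr_sqr ler_wsqrtr// lerDr sqr_ge0. Qed.

Lemma normc_le_ReIm (a b : R) : normc (a +i* b) <= `|a| + `|b|.
Proof.
rewrite -[leRHS]ger0_norm ?addr_ge0// -sqrtr_sqr ler_wsqrtr//.
rewrite sqrrD !real_normK ?num_real//.
by rewrite addrAC lerDl mulrn_wge0// mulr_ge0.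
Qed.

Lemma le_normcB z w : normc z - normc w <= normc (z + w).
Proof.
rewrite lerBlDr -[leRHS](congr1 (fun x => _ + x) (normcN w)).
by rewrite (le_trans _ (le_normcD _ _)) ?addrK.
Qed.

Lemma Re_add z w : complex.Re (z + w) = complex.Re z + complex.Re w.
Proof. by case: z; case: w. Qed.

Lemma Re_opp z : complex.Re (- z) = - complex.Re z.
Proof. by case: z. Qed.

Lemma Re_scale (a : R) z : complex.Re (a%:C * z) = a * complex.Re z.
Proof. by case: z => ? ? /=; rewrite mul0r subr0. Qed.

Lemma Re_mulNi z : complex.Re (- 'i * z) = complex.Im z.
Proof. by case: z => ? ? /=; ring. Qed.

Lemma sqr_normcE z : normc z ^+ 2 = complex.Re z ^+ 2 + complex.Im z ^+ 2.
Proof. by case: z => a b /=; rewrite sqr_sqrtr// addr_ge0 ?sqr_ge0. Qed.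

End ComplexModulus.

(** * Second-order expansions of complex functions *)

Section LocallyBounded.
Variable R : realType.
Local Notation C := R[i].

(** Bounded in a neighbourhood of the origin: the remainders of the expansions
    below belong to this class, which is stable under ring operations. *)
Definition bounded_near0 (rho : C -> C) := exists M r : R,
  0 < r /\ forall h, normc h <= r -> normc (rho h) <= M.

Lemma bounded_near0_cst c : bounded_near0 (fun=> c).
Proof. by exists (normc c), 1. Qed.

Lemma bounded_near0_id : bounded_near0 id.
Proof. by exists 1, 1. Qed.

Lemma bounded_near0D f g : bounded_near0 f -> bounded_near0 g -> bounded_near0 (fun h => f h + g h).
Proof.
move=> [M [r [r0 fM]]] [N [s [s0 gN]]]; exists (M + N), (Num.min r s).
split; first by rewrite lt_min r0.
move=> h; rewrite le_min => /andP[hr hs].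
by rewrite (le_trans (le_normcD _ _))// lerD ?fM ?gN.
Qed.

Lemma bounded_near0M f g : bounded_near0 f -> bounded_near0 g -> bounded_near0 (fun h => f h * g h).
Proof.
move=> [M [r [r0 fM]]] [N [s [s0 gN]]]; exists (M * N), (Num.min r s).
split; first by rewrite lt_min r0.
move=> h; rewrite le_min => /andP[hr hs].
by rewrite normcM ler_pM ?normc_ge0 ?fM ?gN.
Qed.

Lemma bounded_near0X f n : bounded_near0 f -> bounded_near0 (fun h => f h ^+ n).
Proof.
move=> lf; elim: n => [|n IH]; first exact: bounded_near0_cst.
have [M [r [r0 H]]] := bounded_near0M lf IH; exists M, r; split=> // h hr.
by rewrite exprS; apply: H.
Qed.

Lemma bounded_near0N f : bounded_near0 f -> bounded_near0 (fun h => - f h).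
Proof.
by move=> [M [r [r0 H]]]; exists M, r; split=> // h /H; rewrite normcN.
Qed.

Lemma bounded_near0_near f g (r : R) : 0 < r -> (forall h, normc h <= r -> f h = g h) ->
  bounded_near0 f -> bounded_near0 g.
Proof.
move=> r0 fg [M [s [s0 H]]]; exists M, (Num.min r s).
split; first by rewrite lt_min r0.
by move=> h; rewrite le_min => /andP[/fg <- /H].
Qed.

Lemma bounded_near0_small f (e : R) : bounded_near0 f -> 0 < e -> exists2 r : R, 0 < r &
  forall h, normc h <= r -> normc (h * f h) <= e.
Proof.
move=> [M [r [r0 H]]] e0.
have M0 : 0 <= M by rewrite (le_trans _ (H 0 _)) ?normc_ge0// normc0 ltW.
exists (Num.min r (e / (M + 1))); first by rewrite lt_min r0 divr_gt0// ltr_wpDl.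
move=> h; rewrite le_min => /andP[/H hM].
rewrite ler_pdivlMr ?ltr_wpDl// => he; rewrite normcM.
apply: le_trans he; rewrite ler_wpM2l ?normc_ge0// (le_trans hM)//.
by rewrite lerDl.
Qed.

(** The remainder of an inverse is controlled once the denominator stays away
    from zero. *)
Lemma bounded_near0V (a : C) f : a != 0 -> bounded_near0 f -> exists2 r : R, 0 < r &
  exists2 M, True & forall h, normc h <= r ->
    a + h * f h != 0 /\ normc ((a + h * f h)^-1) <= M.
Proof.
move=> a0 lf; have na := normc_gt0 a0.
have [r r0 H] := bounded_near0_small lf (divr_gt0 na (ltr0n _ 2)).
exists r => //; exists (normc a / 2)^-1 => // h /H hh.
have D : normc a / 2 <= normc (a + h * f h).
  apply: le_trans (le_normcB _ _); rewrite lerBrDr (le_trans (lerD (lexx _) hh))//.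
  by rewrite -splitr.
have D0 : 0 < normc (a + h * f h) by rewrite (lt_le_trans _ D)// divr_gt0.
split; last by rewrite normcV lef_pV2 ?posrE// divr_gt0.
by apply: contraTneq D0 => ->; rewrite normc0 ltxx.
Qed.

End LocallyBounded.

Local Ltac prove_bounded := repeat first
  [ assumption | exact: bounded_near0_cst | exact: bounded_near0_id | apply: bounded_near0N
  | apply: (@bounded_near0X _ id) | apply: bounded_near0D | apply: bounded_near0M ].

Section Jets.
Variable R : realType.
Local Notation C := R[i].
Implicit Types (z w h : C) (F G : C -> C).

(** [A] is the value and [B] the derivative of [F] at [w].  The quadratic
    coefficient is kept existential: only its presence matters, because a
    Taylor expansion of order two with a cubic error is exactly what makes the
    four-point Laplacian of [F] vanish to the required order.  The identity is
    asked for every [h], which is no restriction: far from zero it just defines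
    [rho]. *)
Definition jet F w (A B : C) := exists c rho,
  bounded_near0 rho /\ forall h, F (w + h) = A + B * h + c * h ^+ 2 + rho h * h ^+ 3.

Lemma jet_val F w A B : jet F w A B -> F w = A.
Proof.
by move=> [c [rho [_ /(_ 0)]]]; rewrite expr0n /= !mulr0 !addr0 expr0n /= !mulr0 !addr0.
Qed.

(** An expansion valid near [w] is enough: away from zero the remainder may be
    redefined to make the identity hold. *)
Lemma jet_near F w A B c rho (r : R) : 0 < r -> bounded_near0 rho ->
  (forall h, normc h <= r ->
    F (w + h) = A + B * h + c * h ^+ 2 + rho h * h ^+ 3) -> jet F w A B.
Proof.
move=> r0 lr H; pose p h := A + B * h + c * h ^+ 2.
exists c, (fun h => if h == 0 then rho 0 else (F (w + h) - p h) / h ^+ 3); split.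
  apply: (bounded_near0_near r0 _ lr) => h hr; case: eqP => [->//|/eqP h0].
  by rewrite H// /p addrAC subrr add0r mulfK// expf_neq0.
move=> h; case: eqP => [->|/eqP h0].
  by rewrite H ?normc0 ?ltW.
by rewrite mulfVK ?expf_neq0// -/(p h) [RHS]addrC subrK.
Qed.

Lemma jet_ext F G w A B : (forall z, F z = G z) -> jet F w A B -> jet G w A B.
Proof. by move=> FG [c [rho [l H]]]; exists c, rho; split=> // h; rewrite -FG. Qed.

Lemma jet_cst a w : jet (fun=> a) w a 0.
Proof. by exists 0, (fun=> 0); split; [exact: bounded_near0_cst|move=> h; ring]. Qed.

Lemma jetD F G w A B A' B' : jet F w A B -> jet G w A' B' ->
  jet (fun z => F z + G z) w (A + A') (B + B').
Proof.
move=> [c [rho [l H]]] [c' [rho' [l' H']]].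
exists (c + c'), (fun h => rho h + rho' h); split; first exact: bounded_near0D.
by move=> h; rewrite H H'; ring.
Qed.

Lemma jetM F G w A B A' B' : jet F w A B -> jet G w A' B' ->
  jet (fun z => F z * G z) w (A * A') (A * B' + B * A').
Proof.
move=> [c [rho [l H]]] [c' [rho' [l' H']]].
exists (A * c' + B * B' + c * A'), (fun h => (B * c' + c * B' + c * c' * h) +
  (rho h * (A' + B' * h + c' * h ^+ 2) + rho' h * (A + B * h + c * h ^+ 2))
  + rho h * rho' h * h ^+ 3); split.
  by prove_bounded.
by move=> h; rewrite H H'; ring.
Qed.

Lemma jetZ a F w A B : jet F w A B -> jet (fun z => a * F z) w (a * A) (a * B).
Proof. by move=> /(jetM (jet_cst a w)); rewrite mul0r addr0. Qed.

(** The inverse of [A + B h + c h^2] is [A^-1 + B' h + c' h^2] up to a cubic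
    error, where [B' = - B / A^2] and [c' = B^2 / A^3 - c / A^2]. *)
Lemma jetV F w A B : A != 0 -> jet F w A B ->
  jet (fun z => (F z)^-1) w A^-1 (- B / A ^+ 2).
Proof.
move=> A0 [c [rho [l H]]].
pose sg h := B + c * h + rho h * h ^+ 2.
have lsg : bounded_near0 sg.
  by prove_bounded.
have [r r0 [M _ HM]] := bounded_near0V A0 lsg.
pose c' := B ^+ 2 / A ^+ 3 - c / A ^+ 2.
pose tau h := (- (B * c' + c * (- B / A ^+ 2) + c * c' * h) +
   - (rho h * (A^-1 + (- B / A ^+ 2) * h + c' * h ^+ 2))) * (A + h * sg h)^-1.
apply: (@jet_near _ _ _ _ c' tau _ r0).
  have lV : bounded_near0 (fun h => (A + h * sg h)^-1).
    by exists M, r; split=> // h /HM[].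
  by prove_bounded.
move=> h /HM[N0 _].
have FE : F (w + h) = A + h * sg h by rewrite H /sg; ring.
rewrite FE /tau.
apply: (mulfI N0); rewrite divff// [RHS]mulrDr.
have -> a b d : d * (a / d * b) = (d / d) * a * b :> C by ring.
rewrite divff// /sg /c'; field.
by rewrite A0.
Qed.

Lemma jet_shift F w a A B : jet F (w + a) A B -> jet (fun z => F (z + a)) w A B.
Proof.
by move=> [c [rho [l H]]]; exists c, rho; split=> // h; rewrite addrAC H.
Qed.

Lemma jet_scale F w a A B : jet F (a * w) A B ->
  jet (fun z => F (a * z)) w A (a * B).
Proof.
move=> [c [rho [l H]]]; exists (a ^+ 2 * c), (fun h => a ^+ 3 * rho (a * h)).
split; last by move=> h; rewrite mulrDr H; ring.
apply: bounded_near0M; first exact: bounded_near0_cst.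
case: l => M [r [r0 l]]; exists M, (r / (normc a + 1)).
have a1 : 0 < normc a + 1 by rewrite ltr_wpDl ?normc_ge0.
split; first by rewrite divr_gt0.
move=> h; rewrite ler_pdivlMr// => hr; apply: l; rewrite normcM.
apply: le_trans hr; rewrite mulrC ler_wpM2l ?normc_ge0//.
by rewrite lerDl.
Qed.

Lemma jet_continuous F w A B (e : R) : jet F w A B -> 0 < e ->
  exists2 r : R, 0 < r & forall h, normc h <= r -> normc (F (w + h) - A) <= e.
Proof.
move=> [c [rho [l H]]] e0.
have [|r r0 Hr] := @bounded_near0_small _ (fun h => B + c * h + rho h * h ^+ 2) _ _ e0.
  by prove_bounded.
exists r => // h /Hr; rewrite H; congr (normc _ <= _); ring.
Qed.

(** The first-order condition at a one-sided maximum: if [Re F] does not exceed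
    its value at [w] along the ray of direction [d], its derivative there is
    nonpositive.  All sign information on derivatives is extracted this way. *)
Lemma jet_dir F w A B d : jet F w A B ->
  (exists2 r : R, 0 < r & forall t : R, 0 < t <= r ->
     complex.Re (F (w + t%:C * d)) <= complex.Re A) ->
  complex.Re (B * d) <= 0.
Proof.
move=> [c [rho [l H]]] [r r0 Hr].
rewrite leNgt; apply/negP => Bd.
set s := complex.Re (B * d) in Bd.
have d1 : 0 < normc d + 1 by rewrite ltr_wpDl ?normc_ge0.
have [|q q0 Hq] := @bounded_near0_small _ (fun h => c + rho h * h) _ _
  (divr_gt0 (divr_gt0 Bd (ltr0n _ 2)) d1).
  by prove_bounded.
(* A step so small that the terms of order two weigh less than half of [s]. *)
pose t := Num.min r (q / (normc d + 1)).
have t0 : 0 < t by rewrite lt_min r0 divr_gt0.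
have : 0 < t <= r by rewrite t0 /t ge_min lexx.
move=> /Hr; rewrite H.
have tq : normc (t%:C * d) <= q.
  rewrite normcM normc_real gtr0_norm//.
  have : t * (normc d + 1) <= q by rewrite -ler_pdivlMr// /t ge_min lexx orbT.
  by apply: le_trans; rewrite ler_wpM2l ?(ltW t0)// lerDl.
have /= := Hq _ tq; set X := _ * (c + _) => HX.
have -> : A + B * (t%:C * d) + c * (t%:C * d) ^+ 2 + rho (t%:C * d) * (t%:C * d) ^+ 3
  = A + t%:C * (B * d) + t%:C * (d * X) by rewrite /X; ring.
rewrite !Re_add !Re_scale -/s -addrA gerDl -mulrDr pmulr_rle0// leNgt => /negP; apply.
have : normc (d * X) <= s / 2.
  rewrite normcM (le_trans (ler_wpM2l (normc_ge0 _) HX))//.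
  rewrite mulrCA -[leRHS]mulr1 ler_wpM2l ?divr_ge0 ?ltW//.
  by rewrite ltr_pdivrMr// mul1r ltrDl.
move=> /(le_trans (normc_Re_le _)); rewrite ler_norml => /andP[+ _]; lra.
Qed.

Local Open Scope classical_set_scope.

Lemma jet_is_derive (F : C -> C) (x : R) A B : jet F x%:C A B ->
  is_derive x 1 (fun t : R => complex.Re (F t%:C)) (complex.Re B).
Proof.
move=> [c [rho [l H]]].
set f := fun t : R => _.
suff cv : (fun h : R => h^-1 *: ((f \o shift x) (h *: 1) - f x)) @ 0^' --> complex.Re B.
  apply: DeriveDef; first by apply/cvg_ex; exists (complex.Re B).
  exact: cvg_lim cv.
apply/cvgrPdist_le => e e0; near=> h.
have h0 : h != 0 by near: h; exact: nbhs_dnbhs_neq.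
rewrite /= /f [_ *: 1]mulr1 [h + x]addrC rmorphD /= H.
have -> : F x%:C = A.
  by have := H 0; rewrite expr0n /= !mulr0 !addr0 expr0n /= !mulr0 !addr0.
rewrite -!addrA Re_add [complex.Re A + _]addrC addrK.
have -> : B * h%:C + (c * h%:C ^+ 2 + rho h%:C * h%:C ^+ 3) =
  h%:C * (B + h%:C * (c + rho h%:C * h%:C)) by ring.
rewrite Re_scale /GRing.scale /= mulKf// Re_add opprD addNKr normrN.
apply: le_trans (normc_Re_le _) _.
near: h; apply: nbhs_dnbhs.
have [|r r0 Hr] := @bounded_near0_small _ (fun h => c + rho h * h) _ _ e0.
  by prove_bounded.
apply/nbhs_ballP; exists r => //= y; rewrite /ball /= sub0r normrN => yr.
by apply: Hr; rewrite normc_real ltW.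
Unshelve. all: by end_near.
Qed.

End Jets.

(** * The maximum principle on a strip *)

Section Strip.
Local Open Scope classical_set_scope.
Variable R : realType.
Local Notation C := R[i].
Implicit Types (z w h : C) (F G : C -> C).

Definition Re_cts_at F w := forall e : R, 0 < e -> exists2 r : R, 0 < r &
  forall h, normc h <= r -> `|complex.Re (F (w + h)) - complex.Re (F w)| <= e.

Lemma jet_Re_cts_at F w A B : jet F w A B -> Re_cts_at F w.
Proof.
move=> j e e0; have [r r0 H] := jet_continuous j e0; exists r => // h /H.
rewrite (jet_val j); apply: le_trans.
by apply: le_trans (normc_Re_le _); case: (F _) => ? ?; case: (A).
Qed.

(** In the sum over the directions 1, -1, 'i, -'i the odd powers of [h] cancel in
    opposite pairs, and [h^2] takes the values t^2, t^2, -t^2, -t^2; only the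
    cubic remainders survive.  This replaces the vanishing of the Laplacian of
    [Re F]. *)
Lemma stencil_ge F w A B : jet F w A B -> exists M r : R, 0 < r /\
  forall t : R, 0 < t <= r ->
  - (M * t ^+ 3) <= complex.Re (F (w + t%:C)) + complex.Re (F (w - t%:C)) +
    complex.Re (F (w + t%:C * 'i)) + complex.Re (F (w - t%:C * 'i))
    - 4 * complex.Re A.
Proof.
move=> [c [rho [[M [r [r0 l]]] H]]]; exists (4 * M), r; split=> // t /andP[t0 tr].
have bound h : normc h = t -> - (M * t ^+ 3) <= complex.Re (rho h * h ^+ 3).
  move=> ht; have : `|complex.Re (rho h * h ^+ 3)| <= M * t ^+ 3.
    rewrite (le_trans (normc_Re_le _))// normcM normcX ht ler_wpM2r ?exprn_ge0 ?(ltW t0)//.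
    by apply: l; rewrite ht.
  by rewrite ler_norml => /andP[].
have ni : normc ('i : C) = 1 by rewrite /= expr0n expr1n /= add0r sqrtr1.
have nt : normc (t%:C : C) = t by rewrite normc_real gtr0_norm.
have nti : normc (t%:C * 'i : C) = t by rewrite normcM nt ni mulr1.
have b1 := bound _ nt; have b3 := bound _ nti.
have b2 := bound (- t%:C) (etrans (normcN _) nt).
have b4 := bound (- (t%:C * 'i)) (etrans (normcN _) nti).
have i2 : 'i ^+ 2 = -1 :> C by rewrite sqr_i.
rewrite !H -!addrA.
suff -> : forall a1 a2 a3 a4 : C, complex.Re (A + (B * t%:C + (c * t%:C ^+ 2 + a1)))
  + (complex.Re (A + (B * - t%:C + (c * (- t%:C) ^+ 2 + a2))) +
  (complex.Re (A + (B * (t%:C * 'i) + (c * (t%:C * 'i) ^+ 2 + a3))) +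
  (complex.Re (A + (B * (- (t%:C * 'i)) + (c * (- (t%:C * 'i)) ^+ 2 + a4))) -
  4 * complex.Re A))) = complex.Re a1 + complex.Re a2 + complex.Re a3 + complex.Re a4 by lra.
move=> a1 a2 a3 a4.
have -> : c * (t%:C * 'i) ^+ 2 = - (c * t%:C ^+ 2) by rewrite exprMn i2; ring.
have -> : c * (- (t%:C * 'i)) ^+ 2 = - (c * t%:C ^+ 2) by rewrite sqrrN exprMn i2; ring.
rewrite sqrrN !mulrN.
by rewrite !Re_add !Re_opp; ring.
Qed.

(** Phragmen-Lindeloef on a strip, for the real part of a holomorphic function
    that is bounded above at both ends.  The barrier
    [beta (x, y) = x^2 + 2 (b^2 - y^2)] is at least [x^2] on the strip and has
    Laplacian -2.  Hence [Re F - e beta] is at most [M] at the ends of a long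
    rectangle and strictly subharmonic, so its maximum over the rectangle is on
    the boundary; then [e] tends to zero. *)
Lemma strip_maximum_principle F (b M : R) : 0 < b ->
  (forall x y : R, 0 < y < b -> exists A B, jet F (x +i* y) A B) ->
  (forall x y : R, 0 <= y <= b -> Re_cts_at F (x +i* y)) ->
  (forall x : R, complex.Re (F (x +i* 0)) <= M) ->
  (forall x : R, complex.Re (F (x +i* b)) <= M) ->
  (exists K X0 : R, forall x y : R, 0 <= y <= b -> X0 <= `|x| ->
     complex.Re (F (x +i* y)) <= K) ->
  forall x y : R, 0 <= y <= b -> complex.Re (F (x +i* y)) <= M.
Proof.
move=> b0 Fj Fc F0 Fb [K [X0 FK]] x0 y0 y0b.
pose beta (p : R * R) : R := p.1 ^+ 2 + 2 * (b ^+ 2 - p.2 ^+ 2).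
have beta_ge (p : R * R) : 0 <= p.2 <= b -> p.1 ^+ 2 <= beta p.
  by move=> /andP[? ?]; rewrite /beta lerDl mulr_ge0// subr_ge0 ler_sqr ?nnegrE// ltW.
suff main (e : R) : 0 < e -> complex.Re (F (x0 +i* y0)) <= M + e * beta (x0, y0).
  apply/ler_addgt0Pl => d d0; rewrite addrC.
  have b1 : 0 < beta (x0, y0) + 1.
    by rewrite ltr_wpDl// (le_trans _ (beta_ge _ _))// sqr_ge0.
  apply: (le_trans (main _ (divr_gt0 d0 b1))); rewrite lerD2l.
  by rewrite mulrAC ler_pdivrMr// ler_wpM2l ?ltW// ltrDl.
move=> e0.
pose u (p : R * R) := complex.Re (F (p.1 +i* p.2)) - e * beta p.
(* Half-length of a rectangle beyond which the barrier absorbs the bound [K]. *)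
pose X := `|x0| + `|X0| + 1 + `|(K - M) / e|.
have [n1 n2 n3] := And3 (normr_ge0 x0) (normr_ge0 X0) (normr_ge0 ((K - M) / e)).
have [n4 n5] := conj (ler_norm X0) (ler_norm ((K - M) / e)).
have X1 : 1 <= X by rewrite /X; lra.
have x0X : `|x0| <= X by rewrite /X; lra.
have X0X : X0 <= X by rewrite /X; lra.
have KX : K - M <= e * X ^+ 2.
  rewrite mulrC -ler_pdivrMr//.
  have : X <= X ^+ 2 by rewrite expr2 ler_peMr// (le_trans _ X1).
  by apply: le_trans; rewrite /X; lra.
pose D : set (R * R) := `[- X, X]%classic `*` `[0, b]%classic.
have cD : compact D by apply: compact_setX; exact: segment_compact.
have D0 : D (x0, y0).
  by split => /=; rewrite in_itv//= -ler_norml.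
have uc : {within D, continuous u}.
  apply/subspace_continuousP => -[x y] [/= xX yb].
  apply: cvg_within_filter.
  apply: cvgB.
    apply/cvgrPdist_le => /= d d0.
    have [|r r0 Hr] := Fc x y _ _ d0; first by move: yb; rewrite in_itv.
    near=> p.
    have -> : p.1 +i* p.2 = (x +i* y) + ((p.1 - x) +i* (p.2 - y)).
      by simpc; congr (_ +i* _); ring.
    rewrite distrC; apply: Hr; rewrite (le_trans (normc_le_ReIm _ _))// [leRHS]splitr.
    apply: lerD.
      near: p.
      have : (fun p : R * R => p.1) @ nbhs (x, y) --> x by apply: cvg_fst.
      by move=> /cvgrPdist_le/(_ _ (divr_gt0 r0 (ltr0n _ 2))); apply: filterS => p; rewrite distrC.
    near: p.
    have : (fun p : R * R => p.2) @ nbhs (x, y) --> y by apply: cvg_snd.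
    by move=> /cvgrPdist_le/(_ _ (divr_gt0 r0 (ltr0n _ 2))); apply: filterS => p; rewrite distrC.
  have c1 : (fun p : R * R => p.1) @ nbhs (x, y) --> x by apply: cvg_fst.
  have c2 : (fun p : R * R => p.2) @ nbhs (x, y) --> y by apply: cvg_snd.
  apply: cvgM; first exact: cvg_cst.
  apply: cvgD; first by rewrite expr2; apply: (@cvgM _ _ _ _ _ _ x x).
  apply: cvgM; first exact: cvg_cst.
  apply: cvgB; first exact: cvg_cst.
  by rewrite expr2; apply: (@cvgM _ _ _ _ _ _ y y).
have [[x y]] := compact_EVT_max (ex_intro _ _ D0) cD uc.
rewrite inE => -[/=]; rewrite !in_itv/= => /andP[xX1 xX2] /andP[y1 y2] pmax.
have yb : 0 <= y <= b by rewrite y1.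
suff : u (x, y) <= M.
  move=> uM; have /(_ (x0, y0)) := pmax; rewrite inE => /(_ D0) uu.
  by rewrite -lerBlDr; exact: le_trans uu uM.
have ub (q : R * R) : 0 <= q.2 <= b -> complex.Re (F (q.1 +i* q.2)) <= M -> u q <= M.
  move=> qb qM; rewrite /u lerBlDr (le_trans qM)// lerDl mulr_ge0 ?(ltW e0)//.
  by rewrite (le_trans _ (beta_ge _ _)) ?sqr_ge0.
have uX (q : R * R) : 0 <= q.2 <= b -> `|q.1| = X -> u q <= M.
  move=> qb qX; rewrite /u lerBlDr.
  have := FK q.1 q.2 qb; rewrite qX => /(_ X0X)/le_trans; apply.
  have : e * X ^+ 2 <= e * beta q.
    by rewrite ler_wpM2l ?(ltW e0)// (le_trans _ (beta_ge _ qb))// -qX real_normK ?num_real.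
  lra.
have [y0'|y0'] := eqVneq y 0; first by apply: ub => //=; rewrite y0'.
have [yb'|yb'] := eqVneq y b; first by apply: ub => //=; rewrite yb'.
have [xX|xX] := eqVneq x X; first by apply: uX => //=; rewrite xX ger0_norm// (le_trans _ X1).
have [xX'|xX'] := eqVneq x (- X).
  by apply: uX => //=; rewrite xX' normrN ger0_norm// (le_trans _ X1).
have yy1 : 0 < y by rewrite lt_neqAle eq_sym y0'.
have yy2 : y < b by rewrite lt_neqAle yb'.
have xx1 : - X < x by rewrite lt_neqAle eq_sym xX'.
have xx2 : x < X by rewrite lt_neqAle xX.
exfalso.
have [|A [B jF]] := Fj x y; first by rewrite yy1.
have [N [r [r0 St]]] := stencil_ge jF.
(* The four neighbours at distance [t] stay in the rectangle, and the cubic error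
   [N t^3] is below the gain [2 e t^2] due to the barrier. *)
pose t := Num.min (Num.min r (Num.min y (b - y)))
  (Num.min (Num.min (x + X) (X - x)) (e / (`|N| + 1))).
have N1 : 0 < `|N| + 1 by rewrite ltr_wpDl.
have t0 : 0 < t by rewrite /t !lt_min r0 yy1 !subr_gt0 yy2 xx2 divr_gt0// -ltrBlDr sub0r xx1.
have : t <= t by [].
rewrite {2}/t !le_min => /andP[/andP[tr /andP[ty tby]] /andP[/andP[txX tXx] tN]].
have /St : 0 < t <= r by rewrite t0.
have -> : (x +i* y) + t%:C = (x + t) +i* y by simpc.
have -> : (x +i* y) - t%:C = (x - t) +i* y by simpc.
have -> : (x +i* y) + t%:C * 'i = x +i* (y + t) by simpc.
have -> : (x +i* y) - t%:C * 'i = x +i* (y - t) by simpc.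
rewrite -(jet_val jF).
have inD q1 q2 : - X <= q1 <= X -> 0 <= q2 <= b -> u (q1, q2) <= u (x, y).
  by move=> ? ?; apply: pmax; rewrite inE; split; rewrite /= in_itv.
have H1 : u (x + t, y) <= u (x, y).
  by apply: inD => //; rewrite (le_trans xX1) ?lerDl ?(ltW t0)//= -lerBrDl.
have H2 : u (x - t, y) <= u (x, y).
  apply: inD => //; rewrite lerBrDr [- X + t]addrC lerBlDr txX /=.
  by rewrite (le_trans _ xX2)// gerBl ltW.
have H3 : u (x, y + t) <= u (x, y).
  by apply: inD; [rewrite xX1 | rewrite addr_ge0 ?(ltW t0)//= -lerBrDl].
have H4 : u (x, y - t) <= u (x, y).
  apply: inD; first by rewrite xX1.
  by rewrite subr_ge0 ty /= (le_trans _ y2)// gerBl ltW.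
move: H1 H2 H3 H4; rewrite /u /beta /=.
set a1 := complex.Re _; set a2 := complex.Re _; set a3 := complex.Re _.
set a4 := complex.Re _; set a5 := complex.Re _.
have Nt : N * t ^+ 3 < 2 * e * t ^+ 2.
  rewrite exprS mulrA ltr_pM2r ?exprn_gt0//.
  move: tN; rewrite ler_pdivlMr// => tN.
  have : N * t <= `|N| * t by rewrite ler_wpM2r ?(ltW t0)// ler_norm.
  nra.
lra.
Unshelve. all: by end_near.
Qed.
End Strip.

(** * The complex exponential *)

Section Exp.
Variable R : realType.
Local Notation C := R[i].

(** The mean value theorem turns a bound of order [k] on the derivative into one
    of order [k.+1] on the function; iterating it gives the Taylor bounds. *)
Lemma le_of_derive_bound (f df : R -> R) (K : R) (k : nat) : f 0 = 0 ->
  (forall x : R, is_derive x 1 f (df x)) ->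
  (forall x, `|x| <= 1 -> `|df x| <= K * `|x| ^+ k) ->
  forall x, `|x| <= 1 -> `|f x| <= K * `|x| ^+ k.+1.
Proof.
move=> f0 fd dfK x x1.
have fc : continuous f.
  by move=> y; apply/differentiable_continuous/derivable1_diffP; apply: ex_derive.
suff [y yx ->] : exists2 y, `|y| <= `|x| & f x = df y * x.
  rewrite normrM exprSr mulrA ler_wpM2r//.
  have y1 := le_trans yx x1; rewrite (le_trans (dfK _ y1))//.
  have K0 : 0 <= K.
    by have := dfK 1; rewrite normr1 lexx expr1n mulr1 => /(_ isT); apply: le_trans.
  by rewrite ler_wpM2l// lerXn2r// nnegrE.
have [x0|x0] := leP 0 x.
  have [y] := MVT_segment x0 (fun y _ => fd y) (continuous_subspaceT fc).
  rewrite in_itv /= => /andP[y0 yx] ; rewrite f0 !subr0 => ->; exists y => //.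
  by rewrite !ger0_norm.
have [y] := MVT_segment (ltW x0) (fun y _ => fd y) (continuous_subspaceT fc).
rewrite in_itv /= => /andP[y0 yx]; rewrite f0 !sub0r mulrN => /eqP; rewrite eqr_opp => /eqP ->.
by exists y; rewrite // !ler0_norm ?lerN2// (ltW x0).
Qed.

Lemma sin_taylor1 (x : R) : `|x| <= 1 -> `|sin x| <= 1 * `|x| ^+ 1.
Proof.
apply: (@le_of_derive_bound _ cos); first exact: sin0.
by move=> y y1; rewrite expr0 mulr1 ler_norml cos_geN1 cos_le1.
Qed.

Lemma cos_taylor2 (x : R) : `|x| <= 1 -> `|cos x - 1| <= 1 * `|x| ^+ 2.
Proof.
apply: (@le_of_derive_bound (fun x => cos x - 1) (fun x => - sin x)).
- by rewrite cos0 subrr.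
- by move=> y; apply: is_derive_eq; rewrite subr0.
- by move=> y y1; rewrite normrN; apply: sin_taylor1.
Qed.

Lemma sin_taylor3 (x : R) : `|x| <= 1 -> `|sin x - x| <= 1 * `|x| ^+ 3.
Proof.
apply: (@le_of_derive_bound (fun x => sin x - x) (fun x => cos x - 1)).
- by rewrite sin0 subrr.
- exact: cos_taylor2.
Qed.

Lemma cos_taylor3 (x : R) : `|x| <= 1 -> `|cos x - 1 + x ^+ 2 / 2| <= 1 * `|x| ^+ 3.
Proof.
apply: (@le_of_derive_bound (fun x => cos x - 1 + x ^+ 2 / 2) (fun x => - sin x + x)).
- by rewrite cos0 subrr expr0n mul0r addr0.
- by move=> y; apply: is_derive_eq; rewrite /GRing.scale /=; field.
- move=> y y1; rewrite addrC -opprB normrN (le_trans (sin_taylor3 y1))// !mul1r.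
  by rewrite exprS ler_piMl ?exprn_ge0.
Qed.

Lemma expR1_le4 : expR (1 : R) <= 4.
Proof.
(* From 1 - 1/2 <= exp (-1/2), squared and inverted. *)
have h : 1 / 2 <= expR (- (1 / 2) : R).
  by rewrite (le_trans _ (expR_ge1Dx _))//; lra.
have : expR (1 : R) * (expR (- (1 / 2)) * expR (- (1 / 2))) = 1.
  by rewrite -!expRD -[RHS]expR0; congr expR; field.
have := expR_gt0 (1 : R).
have : 1 / 4 <= expR (- (1 / 2) : R) * expR (- (1 / 2)) by nra.
by nra.
Qed.

Lemma expR_taylor3 (x : R) : `|x| <= 1 ->
  `|expR x - 1 - x - x ^+ 2 / 2| <= 4 * `|x| ^+ 3.
Proof.
have e3 (y : R) : `|y| <= 1 -> `|expR y| <= 4 * `|y| ^+ 0.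
  move=> y1; rewrite expr0 mulr1 ger0_norm ?expR_ge0//.
  by rewrite (le_trans _ expR1_le4)// ler_expR (le_trans (ler_norm _)).
apply: (@le_of_derive_bound (fun x => expR x - 1 - x - x ^+ 2 / 2) (fun x => expR x - 1 - x)).
- by rewrite expR0 subrr !subr0 expr0n mul0r subr0.
- by move=> y; apply: is_derive_eq; rewrite /GRing.scale /=; field.
apply: (@le_of_derive_bound (fun x => expR x - 1 - x) (fun x => expR x - 1)).
- by rewrite expR0 subrr !subr0.
- by move=> y; apply: is_derive_eq; rewrite /GRing.scale /=; field.
apply: (@le_of_derive_bound (fun x => expR x - 1) expR) => //.
- by rewrite expR0 subrr.
- by move=> y; apply: is_derive_eq; rewrite /GRing.scale /=; field.
Qed.

Definition cexp (w : C) : C :=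
  (expR (complex.Re w))%:C * (cos (complex.Im w) +i* sin (complex.Im w)).

Lemma cexpD (z w : C) : cexp (z + w) = cexp z * cexp w.
Proof.
case: z => a b; case: w => c d; rewrite /cexp /= expRD cosD sinD; simpc.
by congr (_ +i* _); ring.
Qed.

Lemma cexp0 : cexp 0 = 1.
Proof. by rewrite /cexp /= expR0 cos0 sin0 mul1r. Qed.

Lemma normc_cexp w : normc (cexp w) = expR (complex.Re w).
Proof.
rewrite /cexp normcM normc_real ger0_norm ?expR_ge0//= cos2Dsin2 sqrtr1.
by rewrite mulr1.
Qed.

Lemma cexp_neq0 w : cexp w != 0.
Proof.
apply/eqP => /(congr1 (@normc R)); rewrite normc_cexp normc0 => /eqP.
by rewrite gt_eqF ?expR_gt0.
Qed.

Lemma cexp_conj w : cexp (conjc w) = conjc (cexp w).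
Proof.
by case: w => a b; rewrite /cexp /= cosN sinN; simpc.
Qed.

Lemma cexp_real (x : R) : cexp (x%:C) = (expR x)%:C.
Proof. by rewrite /cexp /= cos0 sin0; simpc. Qed.

Lemma cexp_pi (x : R) : cexp (x +i* pi) = - (expR x)%:C.
Proof. by rewrite /cexp /= cospi sinpi; simpc. Qed.

Lemma cexp_taylor3 (h : C) : normc h <= 1 ->
  normc (cexp h - (1 + h + h ^+ 2 / 2)) <= 20 * normc h ^+ 3.
Proof.
move=> h1; have tr := normc_Re_le h; have ur := normc_Im_le h.
have r0 := normc_ge0 h.
have hE : h = complex.Re h +i* complex.Im h by case: (h).
move: (normc h) h1 tr ur r0 hE => r r1.
move: (complex.Re h) (complex.Im h) => t u tr ur r0 ->.
have t1 := le_trans tr r1; have u1 := le_trans ur r1.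
have := expR_taylor3 t1; set p := expR t - _ - _ - _ => hp.
have := cos_taylor3 u1; set c := cos u - 1 + _ => hc.
have := sin_taylor3 u1; set s := sin u - u => hs.
have -> : cexp (t +i* u) - (1 + (t +i* u) + (t +i* u) ^+ 2 / 2) =
  (- (t * u ^+ 2) / 2 - t ^+ 2 * u ^+ 2 / 4 + p * cos u + c * (1 + t + t ^+ 2 / 2))
  +i* (t ^+ 2 * u / 2 + p * sin u + s * (1 + t + t ^+ 2 / 2)).
  have -> : 1 + (t +i* u) + (t +i* u) ^+ 2 / 2 =
     (1 + t + (t ^+ 2 - u ^+ 2) / 2) +i* (u + t * u) :> C.
    have -> : 1 + (t +i* u) + (t +i* u) ^+ 2 / 2 =
        1 + (t +i* u) + (2^-1)%:C * ((t +i* u) * (t +i* u)).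
      by rewrite fmorphV rmorph_nat; ring.
    by simpc; congr (_ +i* _); field.
  by rewrite /cexp /p /c /s; simpc; congr (_ +i* _); field.
have rr : r ^+ 3 = r * (r * r) by ring.
have r3 (a b d : R) : `|a| <= r -> `|b| <= r -> `|d| <= r -> `|a * (b * d)| <= r ^+ 3.
  by move=> ? ? ?; rewrite rr !normrM !ler_pM// mulr_ge0.
have x3 (a : R) : `|a| <= r -> `|a| ^+ 3 <= r ^+ 3.
  by move=> ar; rewrite lerXn2r// nnegrE.
have hp' : `|p| <= 4 * r ^+ 3 by rewrite (le_trans hp)// ler_pM2l ?x3.
have hc' : `|c| <= r ^+ 3 by rewrite (le_trans hc)// mul1r x3.
have hs' : `|s| <= r ^+ 3 by rewrite (le_trans hs)// mul1r x3.
have b1 := r3 _ _ _ tr ur ur.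
have b2 := r3 _ _ _ tr tr ur.
have b3 : `|t * (u * u) * t| <= r ^+ 3.
  by rewrite normrM -[leRHS]mulr1 ler_pM.
have b4 : `|p * cos u| <= 4 * r ^+ 3.
  by rewrite normrM -[leRHS]mulr1 ler_pM// ler_norml cos_geN1 cos_le1.
have b5 : `|p * sin u| <= 4 * r ^+ 3.
  by rewrite normrM -[leRHS]mulr1 ler_pM// ler_norml sin_geN1 sin_le1.
have q3 : `|1 + t + t ^+ 2 / 2| <= 3.
  move: t1; rewrite !ler_norml => /andP[? ?]; apply/andP; split; nra.
have b6 : `|c * (1 + t + t ^+ 2 / 2)| <= r ^+ 3 * 3 by rewrite normrM ler_pM.
have b7 : `|s * (1 + t + t ^+ 2 / 2)| <= r ^+ 3 * 3 by rewrite normrM ler_pM.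
apply: le_trans (normc_le_ReIm _ _) _.
have -> : 20 * r ^+ 3 = 10 * r ^+ 3 + 10 * r ^+ 3 by ring.
have p3 : 0 <= r ^+ 3 by rewrite exprn_ge0.
move: b1 b2 b3 b4 b5 b6 b7; rewrite ![in X in X -> _]ler_norml.
rewrite !ler_norml => /andP[? ?] /andP[? ?] /andP[? ?] /andP[? ?] /andP[? ?] /andP[? ?] /andP[? ?].
by apply: lerD; rewrite ler_norml; apply/andP; split; nra.
Qed.

Lemma jet_cexp w : jet cexp w (cexp w) (cexp w).
Proof.
pose rho h := if h == 0 then 0 else (cexp h - (1 + h + h ^+ 2 / 2)) / h ^+ 3.
apply: (@jet_near _ _ _ _ _ (cexp w / 2) (fun h => cexp w * rho h) 1) => //.
  apply: bounded_near0M; first exact: bounded_near0_cst.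
  exists 20, 1; split=> // h h1; rewrite /rho.
  case: eqP => [_|/eqP h0]; first by rewrite normc0.
  rewrite normcM normcV normcX ler_pdivrMr ?exprn_gt0 ?normc_gt0//.
  exact: cexp_taylor3.
move=> h _; rewrite cexpD /rho; case: eqP => [->|/eqP h0].
  by rewrite cexp0; ring.
by rewrite -[_ * (_ / _) * _]mulrA divfK ?expf_neq0//; ring.
Qed.
End Exp.

(** * Polynomials in the exponential coordinate *)

Section Poly.
Variable R : realType.
Local Notation C := R[i].
Implicit Types (f : {poly C}) (z w : C).

Lemma jet_eq F w A B A' B' : jet F w A B -> A = A' -> B = B' -> jet F w A' B'.
Proof. by move=> j <- <-. Qed.

Lemma jet_horner f w :
  jet (fun w => f.[cexp w]) w f.[cexp w] (cexp w * f^`().[cexp w]).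
Proof.
elim/poly_ind: f => [|f c IH].
  rewrite deriv0 !horner0 mulr0; apply: jet_ext (jet_cst 0 w) => z.
  by rewrite horner0.
apply: jet_ext (jet_eq (jetD (jetM IH (jet_cexp w)) (jet_cst c w)) _ _) => [z||].
- by move: (cexp z) => u; rewrite !hornerE.
- by move: (cexp w) => u; rewrite !hornerE.
- move: (cexp w) => u; rewrite derivD derivM derivX derivC !hornerE; ring.
Qed.

(** The derivative of [w |-> log f(e^w)], that is [z f'(z) / f(z)] at [z = e^w].
    When [f] is a probability generating function, its value at a real [w] is
    the mean of the law tilted by [e^(k w)]. *)
Definition logder f w := cexp w * f^`().[cexp w] / f.[cexp w].

Lemma jet_logder f w : f.[cexp w] != 0 -> exists B, jet (logder f) w (logder f w) B.
Proof.
move=> f0.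
have j := jet_horner f w; have j' := jet_horner f^`() w.
by eexists; apply: jetM (jetM (jet_cexp w) j') (jetV f0 j).
Qed.

Lemma logderiv_prod (s : seq C) z : z \notin s ->
  (\prod_(t <- s) ('X - t%:P))^`().[z] / (\prod_(t <- s) ('X - t%:P)).[z] =
  \sum_(t <- s) (z - t)^-1.
Proof.
elim: s => [|t s IH]; first by rewrite !big_nil derivC horner0 mul0r.
rewrite inE negb_or => /andP[zt zs]; rewrite !big_cons -IH//.
have z1 : z - t != 0 by rewrite subr_eq0.
have z2 : (\prod_(t <- s) ('X - t%:P)).[z] != 0.
  by move: zs; rewrite -[_ \in _](root_prod_XsubC) /root.
move: (\prod_(t <- s) _) z2 => P z2.
by rewrite derivM derivXsubC !hornerE; field; rewrite z2 z1.
Qed.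

Lemma logder_sum (a : C) (s : seq C) w : a != 0 -> cexp w \notin s ->
  logder (a *: \prod_(t <- s) ('X - t%:P)) w = \sum_(t <- s) cexp w / (cexp w - t).
Proof.
move=> a0 ws; rewrite /logder derivZ !hornerZ.
rewrite -mulr_sumr -logderiv_prod//.
have : (\prod_(t <- s) ('X - t%:P)).[cexp w] != 0.
  by move: ws; rewrite -[_ \in _](root_prod_XsubC) /root.
by move: (\prod_(t <- s) _) => P P0; field; rewrite P0 a0.
Qed.

(** Far out in the strip, [e^w] is much larger or much smaller than every root.
    Both ends of the strip are thus treated alike. *)
Lemma far_roots (s : seq C) : 0 \notin s -> exists X0 : R, forall w t,
  X0 <= `|complex.Re w| -> t \in s ->
  2 * normc t <= normc (cexp w) \/ 2 * normc (cexp w) <= normc t.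
Proof.
elim: s => [|t s IH]; first by exists 0.
rewrite inE negb_or eq_sym => /andP[t0 /IH[X0 HX]].
have nt := normc_gt0 t0.
exists (Num.max X0 (Num.max (2 * normc t) (2 / normc t))) => w u.
rewrite !ge_max => /andP[/HX{}HX /andP[h1 h2]]; rewrite inE => /orP[/eqP ->|/HX//].
rewrite normc_cexp; set x := complex.Re w in h1 h2 *.
have [x0|x0] := leP 0 x.
  left; rewrite ger0_norm// in h1; rewrite (le_trans h1)//.
  by rewrite (le_trans _ (expR_ge1Dx _))// lerDr.
right; rewrite ltr0_norm// in h2.
have e0 := expR_gt0 x.
have : 2 / normc t <= expR (- x).
  by rewrite (le_trans h2)// (le_trans _ (expR_ge1Dx _))// lerDr.
by rewrite expRN ler_pdivrMr// -ler_pdivrMl ?invr_gt0// invrK mulrC.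
Qed.

Lemma far_dist (z t : C) : 2 * normc t <= normc z \/ 2 * normc z <= normc t ->
  normc z + normc t <= 3 * normc (z - t).
Proof.
have h1 := le_normcB z (- t); rewrite normcN in h1.
have h2 := le_normcB (- t) z; rewrite normcN [- t + z]addrC in h2.
have := normc_ge0 z; have := normc_ge0 t.
by move=> ? ? [?|?]; lra.
Qed.

Lemma normc_sum (I : Type) (s : seq I) (P : pred I) (F : I -> C) :
  normc (\sum_(i <- s | P i) F i) <= \sum_(i <- s | P i) normc (F i).
Proof.
elim/big_rec2: _ => [|i x y _ h]; first by rewrite normc0.
by rewrite (le_trans (le_normcD _ _))// lerD2l.
Qed.

Lemma nneg_real (x : C) : 0 <= x -> x = (normc x)%:C.
Proof. by move=> x0; rewrite -[LHS]ger0_norm. Qed.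

(** Nonnegative coefficients turn the triangle inequality into a comparison of
    [f] on a circle with its value on the positive axis. *)
Lemma horner_normc f z : (forall k, 0 <= f`_k) ->
  normc f.[z] <= normc f.[(normc z)%:C].
Proof.
move=> f0.
have -> : f.[(normc z)%:C] = (\sum_(k < size f) normc (f`_k * z ^+ k))%:C.
  rewrite horner_coef rmorph_sum; apply: eq_bigr => k _.
  by rewrite {1}(nneg_real (f0 k)) normcM normcX rmorphM rmorphXn.
rewrite horner_coef normc_real ger0_norm; last first.
  by apply: sumr_ge0 => *; exact: normc_ge0.
exact: normc_sum.
Qed.

Lemma horner_conj f z : (forall k, 0 <= f`_k) -> f.[conjc z] = conjc f.[z].
Proof.
move=> f0; rewrite !horner_coef rmorph_sum; apply: eq_bigr => k _.
rewrite rmorphM rmorphXn; congr (_ * _).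
by rewrite (nneg_real (f0 k)); apply/esym; exact: conjc_real.
Qed.

Lemma deriv_nneg f : (forall k, 0 <= f`_k) -> forall k, 0 <= f^`()`_k.
Proof. by move=> f0 k; rewrite coef_deriv mulrn_wge0. Qed.

Lemma conj_xiy (x y : R) : conjc (x +i* y) = x +i* (- y).
Proof. by []. Qed.

Lemma logder_conj f w : (forall k, 0 <= f`_k) -> logder f (conjc w) = conjc (logder f w).
Proof.
move=> f0; rewrite /logder cexp_conj !horner_conj//; last exact: deriv_nneg.
by rewrite !rmorphM fmorphV.
Qed.

Lemma factor_nonzero_roots (f : {poly C}) : f.[0] != 0 ->
  exists2 s : seq C, 0 \notin s & f = lead_coef f *: \prod_(t <- s) ('X - t%:P).
Proof.
move=> f0; have [s fs] := closed_field_poly_normal f.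
exists s => //; apply: contra f0 => s0; rewrite fs hornerZ mulf_eq0.
by rewrite -[(_.[0] == 0)]/(root _ 0) root_prod_XsubC s0 orbT.
Qed.

(** Two points of equal modulus have comparable distances to a root that is far
    from both, so rotating the argument of [f] changes its modulus by a bounded
    factor. *)
Lemma horner_ratio_far f : f.[0] != 0 -> exists K X0 : R, forall w w',
  X0 <= `|complex.Re w| -> complex.Re w = complex.Re w' ->
  normc f.[cexp w'] <= K * normc f.[cexp w].
Proof.
move=> f0; have [s s0 ->] := factor_nonzero_roots f0; set a := lead_coef f.
have [X0 HX] := far_roots s0.
exists (3 ^+ size s), X0 => w w' ww ww'.
rewrite !hornerZ !normcM mulrCA ler_wpM2l ?normc_ge0// {a}.
elim: s s0 HX => [|t s IH]; first by rewrite !big_nil !hornerC mul1r.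
rewrite inE negb_or => /andP[_ s0] HX; rewrite !big_cons !hornerE !normcM exprS mulrACA.
apply: ler_pM; rewrite ?normc_ge0//; last first.
  by apply: IH => // u v uX vs; apply: HX => //; rewrite inE vs orbT.
have /far_dist := HX w t ww (mem_head _ _).
apply: le_trans; rewrite (le_trans (le_normcD _ _))// normcN.
by rewrite !normc_cexp ww'.
Qed.

Lemma logder_bounded_far f : f.[0] != 0 -> exists K X0 : R, forall w,
  X0 <= `|complex.Re w| -> normc (logder f w) <= K.
Proof.
move=> f0; have [s s0 fs] := factor_nonzero_roots f0.
have [X0 HX] := far_roots s0.
exists (3 * (size s)%:R), X0 => w wX.
have h t : t \in s -> normc (cexp w) <= 3 * normc (cexp w - t).
  by move=> /(HX w t wX)/far_dist; apply: le_trans; rewrite lerDl normc_ge0.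
have ws : cexp w \notin s.
  apply/negP => /h; rewrite subrr normc0 mulr0 leNgt => /negP; apply.
  by rewrite normc_gt0// cexp_neq0.
have a0 : lead_coef f != 0.
  by apply: contra f0; rewrite lead_coef_eq0 => /eqP ->; rewrite horner0.
rewrite fs logder_sum// (le_trans (normc_sum _ _ _))//.
have -> : 3 * (size s)%:R = \sum_(t <- s) 3 :> R.
  by rewrite big_const_seq count_predT iter_addr_0 mulr_natr.
rewrite !big_seq; apply: ler_sum => t ts.
rewrite normcM normcV ler_pdivrMr ?h//.
rewrite normc_gt0// subr_eq0; apply: contraNneq ws => -> //.
Qed.

End Poly.

(** * Positivity of the imaginary part of the logarithmic derivative *)

Section Positivity.
Variable R : realType.
Local Notation C := R[i].
Implicit Types (z w : C).
Variable f : {poly C}.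
Hypothesis f0 : f.[0] != 0.
Hypothesis fge0 : forall k, 0 <= f`_k.

(** A reflection argument.  The ratio [f(e^(w - 2 'i th)) / f(e^w)] is holomorphic
    on the strip [0 <= Im w <= th].  On the real axis its modulus is at most 1
    because the coefficients of [f] are nonnegative; on the line [Im w = th] the
    two points are conjugate and the modulus is 1.  By the maximum principle it
    is at most 1 in between, so it is largest on that line, where its derivative
    in the direction of increasing [Im w] is [2 Im (logder f w)]. *)
Lemma Im_logder_ge0 (th x : R) : 0 < th ->
  (forall x y : R, 0 <= y <= th -> f.[cexp (x +i* y)] != 0) ->
  0 <= complex.Im (logder f (x +i* th)).
Proof.
move=> th0 fz.
pose w0 := x +i* th.
have th00 : 0 <= th <= th by rewrite ltW/=.
have D0 : f.[cexp w0] != 0 by apply: fz.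
pose c : C := 0 +i* (- 2 * th).
have wc (u : R) : (u +i* th) + c = conjc (u +i* th).
  by rewrite /c; simpc; congr (_ +i* _); ring.
have N0 (u : R) : normc f.[cexp ((u +i* th) + c)] = normc f.[cexp (u +i* th)].
  by rewrite wc cexp_conj horner_conj//; case: f.[_] => ? ? /=; rewrite sqrrN.
(* A unimodular factor that makes the ratio equal to 1 at [w0]. *)
pose lam := f.[cexp w0] / f.[cexp (w0 + c)].
have lam1 : normc lam = 1.
  by rewrite normcM normcV [normc f.[cexp (w0 + c)]]N0 divff// gt_eqF// normc_gt0.
pose F w := lam * (f.[cexp (w + c)] / f.[cexp w]).
have jF w : f.[cexp w] != 0 -> jet F w (F w) (lam * (f.[cexp (w + c)] *
    (- (cexp w * f^`().[cexp w]) / f.[cexp w] ^+ 2) +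
    cexp (w + c) * f^`().[cexp (w + c)] / f.[cexp w])).
  move=> fw.
  exact: (jetZ lam (jetM (jet_shift (jet_horner f (w + c))) (jetV fw (jet_horner f w)))).
have nF w : f.[cexp w] != 0 -> normc f.[cexp (w + c)] <= normc f.[cexp w] -> complex.Re (F w) <= 1.
  move=> fw h; apply: le_trans (ler_norm _) _; apply: le_trans (normc_Re_le _) _.
  by rewrite /F normcM lam1 mul1r normcM normcV ler_pdivrMr ?normc_gt0// mul1r.
have F1 : forall x y : R, 0 <= y <= th -> complex.Re (F (x +i* y)) <= 1.
  apply: strip_maximum_principle => //.
  - move=> u y /andP[y0 y1]; do 2 eexists; apply: jF; apply: fz.
    by rewrite !ltW.
  - by move=> u y yy; apply: jet_Re_cts_at (jF _ _); apply: fz.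
  - move=> u; apply: nF; first by apply: fz; rewrite lexx ltW.
    have := horner_normc (cexp ((u +i* 0) + c)) fge0; rewrite normc_cexp /= addr0.
    by rewrite -cexp_real.
  - by move=> u; apply: nF; [exact: fz|rewrite N0].
  have [K [X0 HK]] := horner_ratio_far f0; exists K, X0 => u y yy uX.
  have fw := fz u y yy.
  apply: le_trans (ler_norm _) _; apply: le_trans (normc_Re_le _) _.
  rewrite /F normcM lam1 mul1r normcM normcV ler_pdivrMr ?normc_gt0//.
  by apply: HK => //=; rewrite addr0.
have F0 : F w0 = 1.
  rewrite /F /lam mulrA divfK ?divff//.
  by apply: contra_neq D0 => h; apply: eq0_normc; rewrite -N0 h normc0.
(* Move down from [w0], into the strip. *)
have := jet_dir (d := 0 +i* (- 1)) (jF w0 D0) _.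
have -> : lam * (f.[cexp (w0 + c)] * (- (cexp w0 * f^`().[cexp w0]) / f.[cexp w0] ^+ 2) +
    cexp (w0 + c) * f^`().[cexp (w0 + c)] / f.[cexp w0]) = conjc (logder f w0) - logder f w0.
  rewrite /lam /w0 wc -logder_conj// /logder -/w0.
  have D0' : f.[cexp (conjc w0)] != 0.
    by rewrite -wc; apply: contra_neq D0 => h; apply: eq0_normc; rewrite -N0 h normc0.
  by field; rewrite D0 D0'.
rewrite F0 /=.
have -> : complex.Re ((conjc (logder f w0) - logder f w0) * (0 +i* (-1))) =
    - 2 * complex.Im (logder f w0).
  by case: (logder f w0) => p r; simpc => /=; ring.
move=> h; suff : -2 * complex.Im (logder f w0) <= 0 by rewrite -/w0; lra.
apply: h; exists th => // t /andP[t0 t1].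
rewrite /w0; simpc; apply: F1; apply/andP; split; lra.
Qed.

End Positivity.

(** * Distortion of the logarithmic derivative along the reals *)

Section Distortion.
Variable R : realType.
Local Notation C := R[i].
Implicit Types (z w : C).

(** [e^(s w)] maps the strip of width [pi / |s|] one-to-one into a closed
    half-plane. *)
Lemma cexp_eq1 (s x y b : R) : 0 <= y <= b -> `|s| * b = pi -> s != 0 ->
  cexp (s%:C * (x +i* y)) = 1 -> x = 0 /\ y = 0.
Proof.
move=> /andP[y0 yb] sb s0; simpc => h.
have nh : normc (cexp ((s * x) +i* (s * y))) = 1 by rewrite h normc1.
have x0 : x = 0.
  move: nh; rewrite normc_cexp /= -[RHS]expR0 => /expR_inj/eqP.
  by rewrite mulf_eq0 (negbTE s0) => /eqP.
split=> //; move: h; rewrite x0 mulr0 /cexp /= expR0 mul1r => -[h _].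
have ch : cos (`|s| * y) = 1.
  by case: (ger0P s) => _; rewrite ?mulNr ?cosN.
have : `|s| * y = 0.
  rewrite -[LHS]cosK ?ch ?acos1// in_itv /= mulr_ge0//= -sb.
  by rewrite ler_wpM2l.
by move/eqP; rewrite mulf_eq0 normr_eq0 (negbTE s0) => /eqP.
Qed.

Variable f : {poly C}.
Hypothesis f0 : f.[0] != 0.
Hypothesis fge0 : forall k, 0 <= f`_k.
Variables (b s : R).
Hypothesis b0 : 0 < b.
Hypothesis fz : forall x y : R, 0 <= y <= b -> f.[cexp (x +i* y)] != 0.
Hypothesis sb : `|s| * b = pi.

Let s0 : s != 0.
Proof.
by apply: contra_eqN sb => /eqP ->; rewrite normr0 mul0r lt_eqF ?pi_gt0.
Qed.

(** The divided difference of [logder f] between 0 and [w] in the coordinate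
    [e^(s w)], in which the strip becomes a half-plane.  Both signs of [s] occur:
    they give the bounds on the two sides of 0.  At [w = 0] the quotient takes
    the junk value 0, which is harmless as only its imaginary part is used there
    and the limit is real. *)
Definition dquot w := (logder f w - logder f 0) / (cexp (s%:C * w) - 1).

Lemma logder_real (x : R) : complex.Im (logder f x%:C) = 0.
Proof.
have := logder_conj (x%:C) fge0; rewrite conjc_real.
by case: (logder f x%:C) => u v [] /=; lra.
Qed.

Lemma jet_dquot (x y : R) : 0 <= y <= b -> (x +i* y) != 0 ->
  exists B, jet dquot (x +i* y) (dquot (x +i* y)) B.
Proof.
move=> yb w0.
have [B jB] := jet_logder (fz x yb).
have E1 : cexp (s%:C * (x +i* y)) - 1 != 0.
  rewrite subr_eq0; apply: contra w0 => /eqP/(cexp_eq1 yb sb s0)[-> ->].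
  by rewrite eqxx.
eexists; apply: jetM (jetD jB (jet_cst (- logder f 0) _)) (jetV E1 _).
exact: jetD (jet_scale (jet_cexp _)) (jet_cst (-1) _).
Qed.

(** As [logder f] is real on the real axis, ['i F] and [- 'i F] both have a constant
    real part there, which bounds [Im V] from both sides. *)
Lemma logder_jet0_real : exists V, complex.Im V = 0 /\ jet (logder f) 0 (logder f 0) V.
Proof.
have h : f.[cexp 0] != 0 by apply: fz; rewrite lexx ltW.
have [V jV] := jet_logder h; exists V; split=> //.
have j1 := jet_dir (d := 1) (jetZ 'i jV) _.
have j2 := jet_dir (d := 1) (jetZ (- 'i) jV) _.
have I0 (u : C) : complex.Im u = 0 -> complex.Re ('i * u) = 0 /\ complex.Re (- 'i * u) = 0.
  by case: u => p r /= ->; split; ring.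
have R0 (t : R) : complex.Im (logder f (0 + t%:C * 1)) = 0 by rewrite add0r mulr1 logder_real.
have R00 : complex.Im (logder f 0) = 0 by rewrite logder_real.
have : complex.Re ('i * V * 1) <= 0.
  by apply: j1; exists 1 => // t _; rewrite (I0 _ (R0 t)).1 (I0 _ R00).1.
have : complex.Re (- 'i * V * 1) <= 0.
  by apply: j2; exists 1 => // t _; rewrite (I0 _ (R0 t)).2 (I0 _ R00).2.
case: (V) => p r; simpc => /= h1 h2; apply/eqP; rewrite eq_le; lra.
Qed.

(** The numerator is [V w] and the denominator [s w] up to terms of order two, with
    [V] and [s] real: the imaginary part tends to zero at the removable
    singularity. *)
Lemma dquot_cts0 : Re_cts_at (fun w => - 'i * dquot w) 0.
Proof.
have [V [V0 [c [rho [l H]]]]] := logder_jet0_real.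
have [] := jetD (jet_scale (jet_cexp (s%:C * 0))) (jet_cst (-1) 0).
move=> c' [rho' [l' H']].
have s1 : s%:C != 0 :> C by rewrite eq_complex /= eqxx andbT.
pose g1 h := c + rho h * h.
pose g2 h := c' + rho' h * h.
have lg1 : bounded_near0 g1 by prove_bounded.
have lg2 : bounded_near0 g2 by prove_bounded.
have [r r0 [M _ HM]] := bounded_near0V s1 lg2.
have q0 : dquot 0 = 0 by rewrite /dquot subrr mul0r.
have qh h : normc h <= r -> h != 0 -> dquot (0 + h) =
    V / s%:C + h * ((g1 h - V / s%:C * g2 h) / (s%:C + h * g2 h)).
  move=> /HM[N0 _] h0; rewrite /dquot H H' mulr0 cexp0 mulr1.
  have -> : logder f 0 + V * h + c * h ^+ 2 + rho h * h ^+ 3 - logder f 0 =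
    h * (V + h * g1 h) by rewrite /g1; ring.
  have -> : 1 + -1 + (s%:C + 0) * h + c' * h ^+ 2 + rho' h * h ^+ 3 =
    h * (s%:C + h * g2 h) by rewrite /g2; ring.
  move: (g1 h) (g2 h) N0 => u v N0; field.
  by rewrite ?s1 ?h0 ?N0.
move=> e e0.
have [|r' r'0 Hr'] := @bounded_near0_small _
    (fun h => (g1 h - V / s%:C * g2 h) / (s%:C + h * g2 h)) e _ e0.
  apply: bounded_near0M; last by exists M, r; split=> // h /HM[].
  apply: bounded_near0D => //; apply: bounded_near0N.
  exact: bounded_near0M (bounded_near0_cst _) lg2.
exists (Num.min r r'); first by rewrite lt_min r0.
move=> h; rewrite le_min => /andP[hr hr'].
have [->|h0] := eqVneq h 0; first by rewrite addr0 subrr normr0 ltW.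
rewrite qh// q0 mulr0 subr0.
have -> : forall u : C, complex.Re (- 'i * (V / s%:C + u)) = complex.Im u.
  move=> [u1 u2]; have -> : V = (complex.Re V)%:C by move: V0; case: (V) => ? ? /= ->.
  by rewrite -fmorphV /=; ring.
by apply: le_trans (normc_Im_le _) _; apply: Hr'.
Qed.

Lemma dquot_bounded_far : exists K X0 : R, forall x y : R, 0 <= y <= b -> X0 <= `|x| ->
  complex.Re (- 'i * dquot (x +i* y)) <= K.
Proof.
have [K [X0 HK]] := logder_bounded_far f0.
have s1 : 0 < `|s| by rewrite normr_gt0.
exists (2 * (K + normc (logder f 0))), (Num.max X0 `|s|^-1) => x y yb.
rewrite ge_max => /andP[xX xs].
rewrite Re_mulNi (le_trans (ler_norm _))// (le_trans (normc_Im_le _))//.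
rewrite /dquot normcM normcV mulrC.
have Gb : normc (logder f (x +i* y) - logder f 0) <= K + normc (logder f 0).
  by rewrite (le_trans (le_normcD _ _))// normcN lerD2r HK.
apply: ler_pM; rewrite ?invr_ge0 ?normc_ge0//.
have sx : 1 <= `|s * x|.
  by rewrite normrM mulrC -ler_pdivrMr// mul1r.
suff d : 1 / 2 <= normc (cexp (s%:C * (x +i* y)) - 1).
  have n0 : 0 < normc (cexp (s%:C * (x +i* y)) - 1) by rewrite (lt_le_trans _ d)// divr_gt0.
  by rewrite -[_^-1]mul1r ler_pdivrMr// mulrC -ler_pdivrMr.
have e1 := le_normcB (cexp (s%:C * (x +i* y))) (- 1).
have e2 := le_normcB (- 1) (cexp (s%:C * (x +i* y))).
rewrite normcN normc1 normc_cexp in e1.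
rewrite normcN normc1 normc_cexp [- 1 + _]addrC in e2.
have re : complex.Re (s%:C * (x +i* y)) = s * x by rewrite /= mul0r subr0.
rewrite re in e1 e2.
have [p|p] := leP 0 (s * x).
  rewrite ger0_norm// in sx.
  have := expR_ge1Dx (s * x); lra.
rewrite ltr0_norm// in sx.
have h1 := expR_ge1Dx (- (s * x)); rewrite expRN in h1.
have h2 := expR_gt0 (s * x).
have : 2 * expR (s * x) <= 1.
  by rewrite -ler_pdivlMr// div1r (le_trans _ h1)//; lra.
lra.
Qed.

Lemma dquot_real (x : R) : complex.Im (dquot x%:C) = 0.
Proof.
rewrite /dquot -rmorphM cexp_real -rmorphB -fmorphV.
have -> : logder f x%:C - logder f 0 = (complex.Re (logder f x%:C) - complex.Re (logder f 0))%:C.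
  have := logder_real x; have := logder_real 0.
  by case: (logder f x%:C) => p1 p2; case: (logder f 0) => p3 p4 /= -> ->; simpc.
by rewrite -rmorphM.
Qed.

(** The quotient is real on the real axis.  On the line [Im w = b] the
    denominator is the negative real [- (e^(s x) + 1)], while the numerator has a
    nonnegative imaginary part by [Im_logder_ge0]. *)
Lemma Im_dquot_le0 (x y : R) : 0 <= y <= b -> complex.Im (dquot (x +i* y)) <= 0.
Proof.
move=> yb; rewrite -Re_mulNi; move: x y yb.
apply: (@strip_maximum_principle _ (fun w => - 'i * dquot w)) => //.
- move=> x y /andP[y0 y1].
  have [||B jB] := @jet_dquot x y; first by rewrite !ltW.
    by rewrite eq_complex /= (gt_eqF y0) andbF.
  by do 2 eexists; apply: jetZ jB.
- move=> x y yb.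
  have [w0|w0] := eqVneq (x +i* y) 0; first by rewrite w0; exact: dquot_cts0.
  by have [B jB] := jet_dquot yb w0; apply: jet_Re_cts_at (jetZ _ jB).
- by move=> x; rewrite Re_mulNi dquot_real.
- move=> x; rewrite Re_mulNi /dquot.
  have -> : cexp (s%:C * (x +i* b)) - 1 = (- (expR (s * x) + 1))%:C.
    have -> : cexp (s%:C * (x +i* b)) = - (expR (s * x))%:C.
      have : s * b = pi \/ s * b = - pi.
        by move: sb; case: (ger0P s) => _ h; [left|right]; rewrite -h ?mulNr ?opprK.
      have -> : s%:C * (x +i* b) = (s * x) +i* (s * b) by simpc.
      case=> ->; first exact: cexp_pi.
      by rewrite -(conj_xiy (s * x) pi) cexp_conj cexp_pi; simpc.
    by rewrite rmorphN rmorphD opprD.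
  have := @Im_logder_ge0 _ f f0 fge0 b x b0 fz.
  have -> : forall u : C, complex.Im ((u - logder f 0) / (- (expR (s * x) + 1))%:C)
     = - (complex.Im u / (expR (s * x) + 1)).
    move=> [u1 u2]; rewrite -fmorphV.
    have := logder_real 0; case: (logder f 0) => p1 p2 /= ->.
    by rewrite invrN; ring.
  by rewrite oppr_le0 => h; rewrite divr_ge0// addr_ge0 ?expR_ge0.
exact: dquot_bounded_far.
Qed.

(** By the Cauchy-Riemann equations the derivative along the real axis is the
    normal derivative of the imaginary part, which vanishes on the axis and is
    nonpositive above it. *)
Lemma dquot_nonincreasing (u v : R) : u <= v -> 0 < u \/ v < 0 ->
  complex.Re (dquot v%:C) <= complex.Re (dquot u%:C).
Proof.
move=> uv uv0.
have nz (t : R) : u <= t <= v -> t%:C != 0 :> C.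
  move=> /andP[ut tv]; rewrite eq_complex /= eqxx andbT.
  by case: uv0 => h; [rewrite gt_eqF//|rewrite lt_eqF//];
    [exact: lt_le_trans h ut|exact: le_lt_trans tv h].
have yb0 : (0 : R) <= 0 <= b by rewrite lexx (ltW b0).
have jq (t : R) : u <= t <= v -> exists2 B, jet dquot t%:C (dquot t%:C) B & complex.Re B <= 0.
  move=> tuv; have [B jB] := jet_dquot yb0 (nz t tuv); exists B => //.
  have := jet_dir (d := 'i) (jetZ (- 'i) jB) _.
  have -> : complex.Re (- 'i * B * 'i) = complex.Re B by case: (B) => ? ? /=; ring.
  apply; exists b => // y /andP[y0 y1].
  have -> : t%:C + y%:C * 'i = t +i* y by simpc.
  by rewrite !Re_mulNi dquot_real Im_dquot_le0// ltW.
have [dq Hdq] : exists dq : R -> R, forall t, u <= t <= v ->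
    is_derive t 1 (fun t : R => complex.Re (dquot t%:C)) (dq t) /\ dq t <= 0.
  have /choice[dq Hdq] : forall t, exists d, u <= t <= v ->
    is_derive t 1 (fun t : R => complex.Re (dquot t%:C)) d /\ d <= 0.
    move=> t; have [tuv|tuv] := boolP (u <= t <= v); last by exists 0.
    have [B jB B0] := jq t tuv; exists (complex.Re B) => _; split=> //.
    exact: jet_is_derive jB.
  by exists dq.
have [|| t] := @MVT_segment _ (fun t : R => complex.Re (dquot t%:C)) dq u v uv.
- by move=> t; rewrite in_itv /= => /andP[ut tv]; apply: (Hdq _ _).1; rewrite !ltW.
- apply: derivable_within_continuous => t; rewrite in_itv/= => tuv.
  by have [d _] := Hdq t tuv; exact: ex_derive.
rewrite in_itv/= => /Hdq[_ d0] /eqP; rewrite subr_eq => /eqP ->.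
by rewrite gerDr mulr_le0_ge0// subr_ge0.
Qed.

(** The quotient decreases along the reals and tends to [V / s] at 0, so its value
    at [x] is at most this limit for [x > 0] and at least for [x < 0]; the factor
    [s] has the sign of [x] and covers both cases.  The limit is expressed
    through the derivative at 0 of [D (e^(s w) - 1) - (logder f w - logder f 0)],
    where [D] is the quotient at [x]. *)
Lemma logder_growth V (x : R) : jet (logder f) 0 (logder f 0) V -> 0 < s * x ->
  s * (complex.Re (logder f x%:C) - complex.Re (logder f 0)) <= complex.Re V * (expR (s * x) - 1).
Proof.
move=> jV sx.
pose D := complex.Re (dquot x%:C).
have qE (t : R) : 0 < s * t -> complex.Re (dquot t%:C) * (expR (s * t) - 1) =
   complex.Re (logder f t%:C) - complex.Re (logder f 0).
  move=> st; have e0 : expR (s * t) - 1 != 0 by rewrite subr_eq0 gt_eqF// expR_gt1.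
  rewrite /dquot -rmorphM cexp_real -rmorphB -fmorphV.
  case: (logder f t%:C) => p1 p2; case: (logder f 0) => p3 p4 /=.
  by rewrite mulr0 subr0 divfK.
rewrite -qE// mulrA ler_pM2r ?subr_gt0 ?expR_gt1// -/D.
have jPhi := jetZ s%:C (jetD (jetZ D%:C (jetD (jet_scale (jet_cexp (s%:C * 0))) (jet_cst (-1) 0)))
   (jetZ (-1) (jetD jV (jet_cst (- logder f 0) 0)))).
have := jet_dir (d := x%:C) jPhi _.
have -> : complex.Re (s%:C * (D%:C * (s%:C * cexp (s%:C * 0) + 0) + -1 * (V + 0)) * x%:C) =
  (s * x) * (s * D - complex.Re V).
  by rewrite mulr0 cexp0; case: (V) => v1 v2; simpc => /=; ring.
rewrite pmulr_rle0// subr_le0; apply.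
exists 1 => // t /andP[t0 t1].
have st : 0 < s * (t * x) by rewrite mulrCA mulr_gt0.
rewrite add0r mulr0 cexp0 -!rmorphM !cexp_real.
have -> : complex.Re (s%:C * (D%:C * (1 + -1) + -1 * (logder f 0 - logder f 0))) = 0.
  by rewrite !subrr !mulr0 addr0 mulr0.
have -> : complex.Re (s%:C * (D%:C * ((expR (s * (t * x)))%:C + -1) +
      -1 * (logder f (t * x)%:C - logder f 0))) =
    s * (D * (expR (s * (t * x)) - 1) -
      (complex.Re (logder f (t * x)%:C) - complex.Re (logder f 0))).
  by case: (logder f _) => ? ?; case: (logder f _) => ? ?; simpc => /=; ring.
rewrite -qE// -mulrBl [X in X <= _]mulrA pmulr_lle0 ?subr_gt0 ?expR_gt1//.
have [s_lt0|s_gt0|s_eq0] := ltgtP s 0; last by move: sx; rewrite s_eq0 mul0r ltxx.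
- have x_lt0 : x < 0 by rewrite -(nmulr_rgt0 _ s_lt0).
  rewrite nmulr_rle0// subr_ge0 dquot_nonincreasing//; last by right; rewrite pmulr_rlt0.
  nra.
- have x_gt0 : 0 < x by rewrite -(pmulr_rgt0 _ s_gt0).
  rewrite pmulr_rle0// subr_le0 dquot_nonincreasing//; last by left; rewrite mulr_gt0.
  nra.
Qed.

End Distortion.

(** * Growth forced by the location of the roots *)

Section Growth.
Variable R : realType.
Local Notation C := R[i].
Implicit Types (z w : C).

Lemma Re_div_sub z t : z != t -> complex.Re (z / (z - t)) =
  1 / 2 + (normc z ^+ 2 - normc t ^+ 2) / (2 * normc (z - t) ^+ 2).
Proof.
move=> zt; have D0 : normc (z - t) ^+ 2 != 0.
  by rewrite expf_neq0// gt_eqF// normc_gt0// subr_eq0.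
move: D0; rewrite !sqr_normcE.
case: z zt => a b; case: t => c d _ /= D0.
by field.
Qed.

(** The map [t |-> z / (z - t)] sends the disc of radius [|z|] into the half-plane
    where the real part exceeds 1/2, and the excess is governed by the relative
    gap between the moduli. *)
Lemma Re_far k z t : 0 <= k -> z != t ->
  k * (normc z + normc t) <= normc z - normc t ->
  (1 + k) / 2 <= complex.Re (z / (z - t)).
Proof.
move=> k0 zt h; rewrite Re_div_sub// mulrDl lerD2l.
have D0 : 0 < normc (z - t) ^+ 2 by rewrite exprn_gt0// normc_gt0// subr_eq0.
rewrite (ler_pdivlMr _ _ (mulr_gt0 (ltr0n R 2) D0)).
have -> : k / 2 * (2 * normc (z - t) ^+ 2) = k * normc (z - t) ^+ 2 by field.
have S : normc (z - t) <= normc z + normc t.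
  by rewrite (le_trans (le_normcD _ _))// normcN.
rewrite (@le_trans _ _ (k * (normc z + normc t) ^+ 2))//.
  by rewrite ler_wpM2l// lerXn2r// nnegrE ?addr_ge0 ?normc_ge0.
by rewrite subr_sqr expr2 mulrA ler_wpM2r// addr_ge0 ?normc_ge0.
Qed.

Lemma Re_near k z t : 0 <= k -> z != t ->
  k * (normc z + normc t) <= normc t - normc z ->
  complex.Re (z / (z - t)) <= (1 - k) / 2.
Proof.
move=> k0 zt h; have := @Re_far k t z k0; rewrite eq_sym addrC => /(_ zt h).
have -> : t / (t - z) = 1 - z / (z - t).
  by field; rewrite !subr_eq0 zt eq_sym.
have -> : complex.Re (1 - z / (z - t)) = 1 - complex.Re (z / (z - t)).
  by case: (_ / _).
lra.
Qed.

(** Two moduli in the ratio [expR e] have a difference of at least [e / 3] times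
    their sum. *)
Lemma expR_gap (e : R) : 0 <= e <= 1 -> 1 + e / 3 <= (1 - e / 3) * expR e.
Proof.
move=> /andP[e0 e1]; have := expR_ge1Dx e; nra.
Qed.

Variables (f : {poly C}) (n : nat) (delta rho : R) (V : C).
Hypothesis f0 : f.[0] != 0.
Hypothesis fge0 : forall k, 0 <= f`_k.
Hypothesis szf : size f = n.+1.
Hypothesis n0 : (0 < n)%N.
Hypothesis delta0 : 0 < delta.
Hypothesis rho1 : 1 <= rho.
Hypothesis fr : forall z, root f z ->
  delta <= `|carg z| /\ (rho^-1)%:C <= `|z| <= rho%:C.
Hypothesis jV : jet (logder f) 0 (logder f 0) V.

Lemma root_normc z : root f z -> rho^-1 <= normc z <= rho.
Proof.
by move=> /fr[_]; rewrite normc_def !lecR; case: z.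
Qed.

Lemma exists_root : exists z, root f z.
Proof. by apply/closed_rootP; rewrite szf eqSS -lt0n. Qed.

(** Some root exists, and its argument is at most [pi]. *)
Lemma delta_le_pi : delta <= pi.
Proof.
have [z rz] := exists_root.
have z0 : z != 0 by apply: contraNneq f0 => z0; move: rz; rewrite z0.
have [h _] := carg_spec z0; have [+ _] := fr rz.
by move=> /le_trans; apply; rewrite ler_norml.
Qed.

Lemma zero_free (x y : R) : 0 <= y <= delta / 2 -> f.[cexp (x +i* y)] != 0.
Proof.
move=> /andP[y0 yd]; apply/negP => rz.
have [+ _] := fr rz.
have : is_arg (cexp (x +i* y)) y.
  split; last by exists (expR x) => //; exact: expR_gt0.
  have := delta_le_pi; have := delta0; have := pi_gt0 R => ? ? ?; apply/andP; split; lra.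
by move=> /is_arg_norm <-; rewrite ger0_norm//; have := delta0; lra.
Qed.

(** Each root [t] contributes [Re (z / (z - t))], which is above 1/2 by [e / 6] when
    [z = rho * expR e] lies beyond all the roots, and below by as much when
    [z = (rho * expR e)^-1]. *)
Lemma logder_gap (e : R) : 0 <= e <= 1 ->
  n%:R * (e / 3) <= complex.Re (logder f (ln rho + e)%:C) -
    complex.Re (logder f (- (ln rho + e))%:C).
Proof.
move=> e01; have /andP[e0 e1] := e01.
have [s s0 fs] := factor_nonzero_roots f0.
have lf : lead_coef f != 0.
  by rewrite lead_coef_eq0 -size_poly_eq0 szf.
have ss : size s = n.
  by move: szf; rewrite fs size_scale// size_prod_XsubC => -[].
have rs t : t \in s -> root f t.
  by rewrite fs rootZ// root_prod_XsubC.
have rho0 : 0 < rho by rewrite (lt_le_trans _ rho1).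
have gap := expR_gap e01.
set X := ln rho + e.
have EX : normc (cexp X%:C) = rho * expR e by rewrite normc_cexp /= /X expRD lnK ?posrE.
have EX' : normc (cexp (- X)%:C) = (rho * expR e)^-1.
  by rewrite normc_cexp /= expRN /X expRD lnK ?posrE.
have ns (x : R) : cexp x%:C \notin s.
  apply/negP => /rs; have := @zero_free x 0; rewrite lexx divr_ge0 ?ltW// => /(_ isT).
  by move=> /negP.
rewrite fs !logder_sum//.
have ReS (F : C -> C) : complex.Re (\sum_(t <- s) F t) = \sum_(t <- s) complex.Re (F t).
  by elim/big_rec2: _ => // t u v _ <-; case: (F t) => ? ?; case: v.
rewrite !ReS -sumrB -ss.
have -> : (size s)%:R * (e / 3) = \sum_(t <- s) (e / 3).
  by rewrite big_const_seq count_predT iter_addr_0 mulr_natl.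
rewrite !big_seq; apply: ler_sum => t ts.
have /andP[t1 t2] := root_normc (rs _ ts).
have e3 : 0 <= e / 3 by rewrite divr_ge0.
have h1 : (1 + e / 3) / 2 <= complex.Re (cexp X%:C / (cexp X%:C - t)).
  apply: Re_far => //; first by apply: contraNneq (ns X) => ->.
  rewrite EX; nra.
have h2 : complex.Re (cexp (- X)%:C / (cexp (- X)%:C - t)) <= (1 - e / 3) / 2.
  apply: Re_near => //; first by apply: contraNneq (ns (- X)) => ->.
  rewrite EX'.
  have : (1 + e / 3) * (rho * expR e)^-1 <= (1 - e / 3) * rho^-1.
    rewrite ler_pdivrMr ?mulr_gt0 ?expR_gt0// mulrA mulfVK ?gt_eqF//.
  have : (1 - e / 3) * rho^-1 <= (1 - e / 3) * normc t.
    by rewrite ler_wpM2l//; lra.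
  lra.
lra.
Qed.

(** Combine [logder_gap] with [logder_growth] on both sides of 0.  For
    [a = 2 pi / delta] and [X = ln rho + 1 / a], the increase over [-X, X] is at
    least [n / (3 a)] and at most [2 V e^(a X) / a], where [e^(a X) = e rho^a].
    The margin [1 / a] balances the loss in the first bound against the
    exponential in the second, so that no power of [a] remains.  The constant is
    24 = 3 * 2 * 4, where 4 bounds Euler's number. *)
Lemma logder_slope_lower : n%:R / 24 * expR (- (2 * pi / delta * ln rho)) <= complex.Re V.
Proof.
set a := 2 * pi / delta.
have pi0 := pi_gt0 R.
have a0 : 0 < a by rewrite divr_gt0// mulr_gt0.
have b0 : 0 < delta / 2 by rewrite divr_gt0.
have ab : a * (delta / 2) = pi by rewrite /a; field; rewrite gt_eqF.
have a1 : 1 <= a.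
  rewrite /a ler_pdivlMr// mul1r; have := delta_le_pi; lra.
have l0 : 0 <= ln rho by rewrite ln_ge0.
pose X := ln rho + a^-1.
have X0 : 0 < X by rewrite ltr_wpDl ?invr_gt0.
have na : `|a| * (delta / 2) = pi by rewrite gtr0_norm.
have nna : `|- a| * (delta / 2) = pi by rewrite normrN.
have g1 := logder_growth f0 fge0 b0 zero_free na jV (mulr_gt0 a0 X0).
have aX : 0 < - a * - X by rewrite mulrNN mulr_gt0.
have g2 := logder_growth f0 fge0 b0 zero_free nna jV aX.
have gap : n%:R * (a^-1 / 3) <= _ := @logder_gap a^-1 _.
have {}gap := gap ltac:(by rewrite invr_ge0 ltW//= invf_le1).
rewrite -/X in gap; rewrite mulrNN in g2.
have EX : expR (a * X) = expR (a * ln rho) * expR 1.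
  by rewrite /X mulrDr divff ?gt_eqF// expRD.
have E4 := expR1_le4 R.
have L0 := expR_gt0 (a * ln rho).
have V0 : 0 <= complex.Re V.
  have : 0 <= a * (complex.Re (logder f X%:C) - complex.Re (logder f (- X)%:C)).
    rewrite mulr_ge0 ?(ltW a0)// (le_trans _ gap)// mulr_ge0// divr_ge0// invr_ge0 ltW//.
  have : 1 < expR (a * X) by rewrite expR_gt1 mulr_gt0.
  nra.
rewrite expRN ler_pdivrMr//.
have : n%:R / 3 <= 2 * complex.Re V * expR (a * X).
  have : a * (n%:R * (a^-1 / 3)) <=
      a * (complex.Re (logder f X%:C) - complex.Re (logder f (- X)%:C)).
    by rewrite ler_wpM2l// ltW.
  have -> : a * (n%:R * (a^-1 / 3)) = n%:R / 3 by field; rewrite gt_eqF.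
  lra.
have : complex.Re V * (expR (a * ln rho) * expR 1) <= complex.Re V * (expR (a * ln rho) * 4).
  by rewrite ler_wpM2l// ler_wpM2l// ltW.
rewrite -EX; lra.
Qed.

End Growth.

(** * The variance as a slope of the logarithmic derivative *)

Section SlopeAtZero.
Variable R : realType.
Local Notation C := R[i].

(** For a probability generating function the slope is
    [E X + E X(X-1) - (E X)^2], the variance. *)
Lemma jet_logder0 (f : {poly C}) : f.[1] = 1 ->
  jet (logder f) 0 (logder f 0) (f^`().[1] + f^`()^`().[1] - f^`().[1] ^+ 2).
Proof.
move=> f1; have f0 : f.[cexp 0] != 0 by rewrite cexp0 f1 oner_eq0.
apply: jet_eq (jetM (jetM (jet_cexp _) (jet_horner f^`() 0)) (jetV f0 (jet_horner f 0))) _ _ => //.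
by rewrite cexp0 f1; field.
Qed.
End SlopeAtZero.

Section Moments.
Variables (R : realType) (n : nat) (p : nat -> R).
Local Notation C := R[i].
Let f : {poly C} := \poly_(k < n.+1) (p k)%:C.
Let mom (g : nat -> R) := \sum_(k < n.+1) g k * p k.

Lemma horner1_poly : f.[1] = (mom (fun=> 1))%:C.
Proof.
rewrite /f poly_def horner_sum /mom rmorph_sum; apply: eq_bigr => k _.
by rewrite hornerZ hornerXn expr1n mulr1 mul1r.
Qed.

Lemma deriv1_poly : f^`().[1] = (mom (fun k => k%:R))%:C.
Proof.
rewrite /f poly_def raddf_sum horner_sum /mom rmorph_sum; apply: eq_bigr => k _.
by rewrite /= derivZ derivXn hornerZ hornerMn hornerXn expr1n rmorphM rmorph_nat mulrC.
Qed.

Lemma deriv2_poly : f^`()^`().[1] = (mom (fun k => k%:R * k.-1%:R))%:C.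
Proof.
rewrite /f poly_def /mom !raddf_sum horner_sum; apply: eq_bigr => k _.
rewrite /= derivZ derivXn derivZ derivMn derivXn hornerZ !hornerMn hornerXn expr1n.
by rewrite !rmorphM !rmorph_nat -mulrnA mulrC -natrM mulnC.
Qed.

Lemma variance_poly : mom (fun=> 1) = 1 ->
  complex.Re (f^`().[1] + f^`()^`().[1] - f^`().[1] ^+ 2) =
  mom (fun k => (k%:R - mom (fun k => k%:R)) ^+ 2).
Proof.
move=> m1; rewrite deriv1_poly deriv2_poly -rmorphXn -rmorphD -rmorphB /=.
set m := mom (fun k => k%:R).
have -> (m' : R) : mom (fun k => (k%:R - m') ^+ 2) =
  mom (fun k => k%:R) + mom (fun k => k%:R * k.-1%:R) - 2 * m' * mom (fun k => k%:R)
   + m' ^+ 2 * mom (fun=> 1).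
  rewrite /mom !mulr_sumr -!big_split /= -sumrB -big_split /=; apply: eq_bigr => k _.
  by case: (nat_of_ord k) => [|j] /=; [|rewrite -[j.+1]addn1 natrD]; ring.
by rewrite m1 -/m; ring.
Qed.
End Moments.

Section FiniteSupport.
Local Open Scope classical_set_scope.
Context d (T : measurableType d) (R : realType) (P : probability T R) (X : {RV P >-> R}) (n : nat).
Hypothesis Xn : forall t : T, exists k : nat, (k <= n)%N /\ X t = k%:R.

Lemma expectation_fun (g : R -> R) : (forall k : nat, 0 <= g k%:R) ->
  'E_P[fun t => g (X t)]%E = (\sum_(k < n.+1) g k%:R * pmf X k%:R)%:E.
Proof.
move=> g0; rewrite unlock.
have mX (k : nat) : measurable (X @^-1` [set k%:R : R]) by exact: measurable_funPTI.
under eq_integral => w _.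
  have -> : (g (X w))%:E = (\sum_(k < n.+1) (g k%:R)%:E * (\1_(X @^-1` [set k%:R : R]) w)%:E)%E.
    have [j [jn Xj]] := Xn w.
    rewrite (bigD1 (Ordinal (jn : (j < n.+1)%N)))//= big1 => [|i ij].
      by rewrite indicE mem_set//= mule1 adde0 Xj.
    rewrite indicE memNset ?mule0//= Xj => /eqP; rewrite eqr_nat => /eqP ji.
    by move/eqP: ij; apply; apply/val_inj.
  over.
rewrite ge0_integral_sum//; last 2 first.
- move=> k; apply: measurable_funeM.
  by apply/measurable_EFinP; exact: measurable_indic.
- by move=> k w _; rewrite mule_ge0// lee_fin.
rewrite -sumEFin; apply: eq_bigr => k _.
rewrite ge0_integralZl_EFin//; last first.
  by apply/measurable_EFinP; exact: measurable_indic.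
rewrite integral_indic// setIT /pmf EFinM fineK//.
exact: fin_num_measure.
Qed.

Lemma pmf_sum1 : \sum_(k < n.+1) 1 * pmf X k%:R = 1.
Proof.
have := @expectation_fun (fun=> 1) (fun=> ler01).
by rewrite (expectation_cst P 1) => -[].
Qed.

Lemma variance_pmf : 'V_P[X]%E = (\sum_(k < n.+1)
  (k%:R - \sum_(k < n.+1) k%:R * pmf X k%:R) ^+ 2 * pmf X k%:R)%:E.
Proof.
have EX : 'E_P[X]%E = (\sum_(k < n.+1) k%:R * pmf X k%:R)%:E.
  by rewrite -(@expectation_fun id).
rewrite /variance unlock EX /=.
set m := \sum_(_ < _) _.
rewrite -(@expectation_fun (fun x => (x - m) ^+ 2)) => [|k]; last exact: sqr_ge0.
by congr expectation; apply/funext => t /=; rewrite expr2.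
Qed.
End FiniteSupport.

Theorem theorem2 (R : realType) :
  exists c : R, 0 < c /\
    forall (n : nat) (d : measure_display) (T : measurableType d)
      (P : probability T R) (X : {RV P >-> R}) (delta rho : R),
      (forall t : T, exists k : nat, (k <= n)%N /\ X t = k%:R) ->
      0 < pmf X 0 * pmf X n%:R ->
      0 < delta -> 1 <= rho ->
      (forall z : R[i], root (pgf X n) z ->
         delta <= `|carg z| /\ (rho^-1)%:C <= `|z| <= rho%:C) ->
      ((c * rho `^ (- (2 * pi / delta)) * n%:R)%:E <= 'V_P[X])%E.
Proof.
exists 24^-1; split=> [|n d T P X delta rho Xn p0n delta0 rho1 fr]; first by rewrite invr_gt0.
have [->|n_gt0] := posnP n; first by rewrite mulr0 variance_ge0.
have p0 : pmf X 0 != 0 by apply: contraTneq p0n => ->; rewrite mul0r ltxx.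
have pn : pmf X n%:R != 0 by apply: contraTneq p0n => ->; rewrite mulr0 ltxx.
pose f := pgf X n.
have f0 : f.[0] != 0.
  by rewrite horner_coef0 coef_poly /= eq_complex /= eqxx andbT.
have fge0 k : 0 <= f`_k.
  by rewrite coef_poly; case: ifP => // _; rewrite ler0c pmf_ge0.
have szf : size f = n.+1 by rewrite size_poly_eq//= eq_complex /= eqxx andbT.
have s1 := pmf_sum1 Xn.
have f1 : f.[1] = 1 by rewrite (horner1_poly n (fun k => pmf X k%:R)) s1.
have := logder_slope_lower f0 fge0 szf n_gt0 delta0 rho1 fr (jet_logder0 f1).
rewrite (variance_poly s1) (variance_pmf Xn) lee_fin.
apply: le_trans; rewrite /powR gt_eqF ?(lt_le_trans _ rho1)// mulNr.
by rewrite mulrC mulrA.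
Qed.
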